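(* Let $(\mathbb{E},d)$ be a complete metric space and let $p,q,r\ge1$ be real numbers with $\frac1p=\frac1q+\frac1r$. Let $\mu$ be a Borel measure on $\mathbb{R}$ such that $\mu(\mathbb{R})=\infty$, $\mu(I)<\infty$ for every bounded interval $I$, and: for every $\tau\in\mathbb{R}$ there exist $\beta>0$ and a bounded interval $I$ such that $\mu(B+\tau)\le\beta\mu(B)$ whenever $B$ is a Borel subset of $\mathbb{R}$ with $B\cap I=\emptyset$. Assume that $F\in\mathbb{S}^p\mathrm{PAPU}_c(\mathbb{R}\times\mathbb{E},\mathbb{E},\mu)$, and let $G\in\mathbb{S}^p\mathrm{APU}_c(\mathbb{R}\times\mathbb{E},\mathbb{E})$ be such that the map $$(t,x)\mapsto H(t,x)=d\bigl(F(t,x),G(t,x)\bigr)$$ belongs to $\mathbb{S}^p\mathcal{E}\mathrm{U}_c(\mathbb{R}\times\mathbb{E},\mathbb{R},\mu)$. Assume that each of $f=F$ and $f=G$ satisfies the following Lipschitz condition: there exists a nonnegative function $L\in\mathbb{S}^r(\mathbb{R})$ such that $d(f(t,u),f(t,v))\le L(t)\,d(u,v)$ for all $t\in\mathbb{R}$ and $u,v\in\mathbb{E}$. If $X\in\mathbb{S}^q\mathrm{PAP}(\mathbb{R},\mathbb{E},\mu)$, then the function $t\mapsto F(t,X(t))$ belongs to $\mathbb{S}^p\mathrm{PAP}(\mathbb{R},\mathbb{E},\mu)$.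
   Context: Stepanov almost periodicity. A measurable $f:\mathbb{R}\to\mathbb{E}$ is locally $p$-integrable if, for some (any) fixed $x_0\in\mathbb{E}$, $\int_a^b d^p(f(t),x_0)\,dt<\infty$ for all $a<b$; functions equal a.e. are identified. $\mathbb{S}^r(\mathbb{R})$ is the set of measurable $L:\mathbb{R}\to\mathbb{R}$ with $\sup_{x}\bigl(\int_x^{x+1}|L(t)|^r\,dt\bigr)^{1/r}<\infty$. Put $D_{\mathbb{S}^p}^d(f,g)=\sup_{x\in\mathbb{R}}\bigl(\int_x^{x+1}d^p(f(t),g(t))\,dt\bigr)^{1/p}$. A set $T\subset\mathbb{R}$ is relatively dense if there is $\ell>0$ with $T\cap[a,a+\ell]\neq\emptyset$ for all $a\in\mathbb{R}$. $\mathbb{S}^p\mathrm{AP}(\mathbb{R},\mathbb{E})$ is the set of locally $p$-integrable $f:\mathbb{R}\to\mathbb{E}$ such that for every $\varepsilon>0$ the set $\{\tau: D^d_{\mathbb{S}^p}(f(\cdot+\tau),f)\le\varepsilon\}$ is relatively dense. $\mathbb{S}^p\mathrm{APU}_c(\mathbb{R}\times\mathbb{E},\mathbb{E})$ is the set of measurable $f:\mathbb{R}\times\mathbb{E}\to\mathbb{E}$ with $f(\cdot,x)\in\mathbb{S}^p\mathrm{AP}(\mathbb{R},\mathbb{E})$ for every $x$ and such that $f(\cdot,x)$ is $\mathbb{S}^p$-almost periodic uniformly with respect to $x\in C$ for every compact $C\subset\mathbb{E}$, i.e. for every $\varepsilon>0$ the set of $\tau$ with $\sup_{x\in C}D^d_{\mathbb{S}^p}(f(\cdot+\tau,x),f(\cdot,x))\le\varepsilon$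 is relatively dense. Ergodicity and pseudo almost periodicity. For a Banach space $\mathbb{X}$, $\mathcal{E}(\mathbb{R},\mathbb{X},\mu)$ is the set of bounded continuous $f:\mathbb{R}\to\mathbb{X}$ with $\lim_{\rho\to\infty}\frac1{\mu([-\rho,\rho])}\int_{[-\rho,\rho]}\|f(t)\|\,d\mu(t)=0$. The Bochner transform of $f$ is $f^b(t)=f(t+\cdot)$, viewed as an element of the space $L^p(0,1;\mathbb{E})$ of measurable $p$-integrable functions on $[0,1]$, with metric $D_{L^p}(f,g)=\bigl(\int_0^1 d^p(f(s),g(s))\,ds\bigr)^{1/p}$. $\mathbb{S}^p\mathcal{E}\mathrm{U}_c(\mathbb{R}\times\mathbb{E},\mathbb{R},\mu)$ is the set of measurable $h:\mathbb{R}\times\mathbb{E}\to\mathbb{R}$, with $h(\cdot,x)$ locally $p$-integrable for all $x$, such that the Bochner transform of $h(\cdot,x)$ is in $\mathcal{E}(\mathbb{R},L^p(0,1;\mathbb{R}),\mu)$ for every $x\in\mathbb{E}$ and $\lim_{\rho\to\infty}\frac1{\mu([-\rho,\rho])}\int_{[-\rho,\rho]}\bigl(\int_0^1|h(t+s,x)|^p\,ds\bigr)^{1/p}d\mu(t)=0$ uniformly with respect to $x$ in compact subsets of $\mathbb{E}$. $\mathbb{S}^p\mathrm{PAPU}_c(\mathbb{R}\times\mathbb{E},\mathbb{E},\mu)$ is the set of measurable $f:\mathbb{R}\times\mathbb{E}\to\mathbb{E}$, with $f(\cdot,x)$ locally $p$-integrable for all $x$, for which there exists $g\in\mathbb{S}^p\mathrm{APU}_c(\mathbb{R}\times\mathbb{E},\mathbb{E})$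 such that $(t,x)\mapsto d(f(t,x),g(t,x))$ is in $\mathbb{S}^p\mathcal{E}\mathrm{U}_c(\mathbb{R}\times\mathbb{E},\mathbb{R},\mu)$. $\mathbb{S}^p\mathrm{PAP}(\mathbb{R},\mathbb{E},\mu)$ (the $\mathbb{S}^p$-weighted, or Stepanov $\mu$-, pseudo almost periodic functions) is the set of locally $p$-integrable $f:\mathbb{R}\to\mathbb{E}$ whose Bochner transform $f^b:\mathbb{R}\to L^p(0,1;\mathbb{E})$ is bounded and continuous and for which there exists $g\in\mathbb{S}^p\mathrm{AP}(\mathbb{R},\mathbb{E})$ with $\lim_{\rho\to\infty}\frac1{\mu([-\rho,\rho])}\int_{[-\rho,\rho]}D_{L^p}(f^b(t),g^b(t))\,d\mu(t)=0$. The same definitions apply with $q$ in place of $p$. *)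

(* Defs.v *)
From HB Require Import structures.
From mathcomp Require Import all_boot all_order all_algebra.
From mathcomp Require Import all_classical all_reals all_analysis.

Set Implicit Arguments.
Unset Strict Implicit.
Unset Printing Implicit Defensive.

Import Order.TTheory GRing.Theory Num.Theory.
Import numFieldNormedType.Exports.

Local Open Scope classical_set_scope.
Local Open Scope ring_scope.

(* [Complete] brings in a base point, which only excludes the empty space. *)
#[short(type="completeMetricType")]
HB.structure Definition CompleteMetric (K : numDomainType) :=
  {T of Metric K T & Complete T}.

HB.instance Definition _ (R : realType) := Complete.on R^o.

Definition borel (T : ptopologicalType) := g_sigma_algebraType (@open T).

Section Stepanov.
Context {R : realType}.
Notation leb := (@lebesgue_measure R).
Notation measureR := {measure set (measurableTypeR R) -> \bar R}.

Section metric_valued.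
Context {E : completeMetricType R}.
Implicit Types (f g : R -> E) (F : R -> E -> E) (p r : R) (mu : measureR).

(* Measurable means Borel measurable, also when [E] is not separable. A Borel
   map from the real line to a metric space always has separable range (a
   theorem of Simpson), so [t |-> mdist (f t) (g t)] is measurable as soon as
   [f] and [g] are, and the integrals below have their usual meaning. *)
Definition locally_integrable_p p f : Prop :=
  measurable_fun [set: R] (f : R -> borel E) /\
  exists x0 : E, forall a b : R, a < b ->
    (\int[leb]_(t in `[a, b]) ((mdist (f t) x0) `^ p)%:E < +oo)%E.

Definition stepanov_dist p f g : \bar R :=
  ereal_sup (range (fun x : R =>
    ((\int[leb]_(t in `[x, (x + 1)%R]) ((mdist (f t) (g t)) `^ p)%:E)
       `^ p^-1)%E)).

(* The metric of L^p(0,1;E), whose elements are represented by functions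
   R -> E of which only the restriction to [0,1] matters. *)
Definition Lp_dist p f g : \bar R :=
  ((\int[leb]_(s in `[0%R, 1%R]) ((mdist (f s) (g s)) `^ p)%:E) `^ p^-1)%E.

Definition bochner_transform f : R -> (R -> E) := fun t s => f (t + s).

Definition Lp_bounded_continuous p (phi : R -> (R -> E)) : Prop :=
  (exists M : R, forall t u, (Lp_dist p (phi t) (phi u) <= M%:E)%E) /\
  (forall t : R, Lp_dist p (phi u) (phi t) @[u --> t] --> 0%E).

Definition relatively_dense (T : set R) : Prop :=
  exists2 l : R, 0 < l & forall a : R, T `&` `[a, a + l] !=set0.

Definition stepanov_AP p f : Prop :=
  locally_integrable_p p f /\
  forall eps : R, 0 < eps ->
    relatively_dense
      [set tau | (stepanov_dist p (fun t => f (t + tau)%R) f <= eps%:E)%E].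

Definition stepanov_APUc p F : Prop :=
  [/\ measurable_fun [set: R * borel E]
        (fun tx => F tx.1 tx.2 : borel E),
      forall x, stepanov_AP p (F ^~ x) &
      forall C : set E, compact C -> forall eps : R, 0 < eps ->
        relatively_dense
          [set tau | (ereal_sup [set stepanov_dist p
                        (fun t => F (t + tau)%R x) (F ^~ x) | x in C]
                      <= eps%:E)%E]].

Definition mean mu (phi : R -> \bar R) (rho : R) : \bar R :=
  ((mu `[(- rho)%R, rho]%classic)^-1
   * \int[mu]_(t in `[(- rho)%R, rho]) phi t)%E.

Definition stepanov_PAP p mu f : Prop :=
  [/\ locally_integrable_p p f,
      Lp_bounded_continuous p (bochner_transform f) &
      exists2 g, stepanov_AP p g &
        mean mu (fun t => Lp_dist p (bochner_transform f t)
                                    (bochner_transform g t)) rho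
          @[rho --> +oo] --> 0%E].

End metric_valued.

Definition stepanov_space (r : R) (L : R -> R) : Prop :=
  measurable_fun [set: R] L /\
  (ereal_sup (range (fun x : R =>
     ((\int[leb]_(t in `[x, (x + 1)%R]) (`|L t| `^ r)%:E) `^ r^-1)%E))
   < +oo)%E.

(* [R^o] is the real line as a metric space, [mdist u v] being [`|v - u|]; so
   this is the norm of L^p(0,1;R). *)
Definition Lp_norm (p : R) (h : R -> R^o) : \bar R := Lp_dist p h (cst 0).

(* The ergodic space E(R, L^p(0,1;R), mu). *)
Definition ergodic_Lp (p : R) (mu : measureR) (phi : R -> (R -> R^o)) : Prop :=
  Lp_bounded_continuous p phi /\
  mean mu (fun t => Lp_norm p (phi t)) rho @[rho --> +oo] --> 0%E.

Section metric_parameter.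
Context {E : completeMetricType R}.

Definition stepanov_EUc (p : R) (mu : measureR) (h : R -> E -> R^o) : Prop :=
  [/\ measurable_fun [set: R * borel E] (fun tx => h tx.1 tx.2 : R),
      forall x, locally_integrable_p p (h ^~ x),
      forall x, ergodic_Lp p mu (bochner_transform (h ^~ x)) &
      forall C : set E, compact C -> forall eps : R, 0 < eps ->
        \forall rho \near +oo, forall x, C x ->
          (mean mu (fun t => Lp_norm p (bochner_transform (h ^~ x) t)) rho
           <= eps%:E)%E].

Definition stepanov_PAPUc (p : R) (mu : measureR) (F : R -> E -> E) : Prop :=
  [/\ measurable_fun [set: R * borel E] (fun tx => F tx.1 tx.2 : borel E),
      forall x, locally_integrable_p p (F ^~ x) &
      exists2 G : R -> E -> E, stepanov_APUc p G &
        stepanov_EUc p mu (fun t x => mdist (F t x) (G t x))].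

Definition stepanov_Lipschitz (r : R) (F : R -> E -> E) : Prop :=
  exists L : R -> R,
    [/\ forall t, 0 <= L t, stepanov_space r L &
        forall t u v, mdist (F t u) (F t v) <= L t * mdist u v].

End metric_parameter.

End Stepanov.

(* Main.v *)
From HB Require Import structures.
Require Import Defs.
From mathcomp Require Import all_boot all_order all_algebra.
From mathcomp Require Import all_classical all_reals all_analysis.
From mathcomp Require Import measurable_realfun ring lra.
Import Order.TTheory GRing.Theory Num.Theory.
Import numFieldNormedType.Exports.
Local Open Scope classical_set_scope.
Local Open Scope ring_scope.

(** Write [Y] for the almost periodic part of [X]. The almost periodic part of
[F(t, X(t))] is [G(t, Y(t))], and everything rests on one device: replacing
[Y(t)] by the nearest point [e k] of a finite net. Because [Y] is almost periodic
in the sense of Stepanov, each of its unit windows is close to a translate of a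
window in a fixed compact interval; hence one finite net approximates [Y] on all
windows with an error [delta] in the mean of order [q] ([stepanov_AP_net]). By the
Lipschitz condition and Hoelder's inequality with [1/p = 1/q + 1/r], replacing
[Y(t)] by [e k] in [F] or [G] costs at most a constant times [delta], and what is
left is controlled by the finitely many functions [G(., e i)] and [H(., e i)].

Almost periodicity of [G(t, Y(t))] ([nemytskii_AP]) needs almost periods common to
[Y] and to the [G(., e i)]. They exist because small translations are almost
periods of [Y] ([common_almost_periods],
[stepanov_AP_uniformly_continuous]), and this in turn comes from the continuity of
translations in the mean ([translation_continuity]). The difference of
[F(t, X(t))] and [G(t, Y(t))] is ergodic ([nemytskii_ergodic]): it is bounded by a
Lipschitz multiple of the distance of [X] and [Y], a small constant, and the
finite sum of the [H(., e i)]. The Bochner transform of [F(t, X(t))] is bounded by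
the same Hoelder estimate, and continuous by the continuity of translations.

All these estimates add integrals of [mdist (f t) (g t)], so this function must be
measurable although [E] may fail to be separable. It is, because a Borel map from
the line to a metric space has separable range ([measurable_range_separable]).
Otherwise the range would contain an uncountable separated set [D], all of whose
subsets are closed; choosing one point in each fibre over [D] would give an
uncountable Borel set of reals with only Borel subsets. But an uncountable Borel
set contains a copy of the Cantor space ([analytic_uncountable_injection]), while
Borel sets are coded by points of the Cantor space ([analytic_decode]), and a
diagonal argument yields a subset that is not Borel
([uncountable_has_nonmeasurable]). *)

Set Implicit Arguments.
Unset Strict Implicit.
Unset Printing Implicit Defensive.

(** * Suslin schemes of closed sets and Borel sets of the line *)

Section analytic_sets.
Context {R : realType}.
Implicit Types (A B : set R) (K : seq nat -> set R) (s : seq nat).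

Lemma mkseqSl (T : Type) (f : nat -> T) n : mkseq f n.+1 = f 0%N :: mkseq (f \o S) n.
Proof. by rewrite /mkseq /= -(addn0 1%N) iotaDl -map_comp. Qed.

(** The result of the Suslin operation: a branch [sigma] of the tree of finite
sequences certifies [x] when [x] lies in the sets attached to all its nodes. *)
Definition suslin K : set R :=
  [set x | exists sigma : nat -> nat, forall n, K (mkseq sigma n) x].

Definition analytic A : Prop := exists2 K, forall s, closed (K s) & A = suslin K.

Lemma closed_analytic A : closed A -> analytic A.
Proof.
move=> cA; exists (fun=> A) => //; apply/seteqP; split => [x Ax|x [? /(_ 0%N)]//].
by exists id.
Qed.

(** The first entry of a branch chooses which set of the union is certified; the
rest of the branch is a certificate for it. *)
Lemma bigcup_analytic (A_ : nat -> set R) :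
  (forall k, analytic (A_ k)) -> analytic (\bigcup_k A_ k).
Proof.
move=> aA.
have /choice[Kf KfP] : forall k, exists K, (forall s, closed (K s)) /\ A_ k = suslin K.
  by move=> k; have [K] := aA k; exists K.
pose K s := if s is k :: s' then Kf k s' else setT.
exists K => [[|k s]|].
- exact: closedT.
- exact: (KfP k).1.
apply/seteqP; split => [x [k _]|x [sigma Kx]].
  rewrite (KfP k).2 => -[sigma Kx].
  exists (fun n => if n is m.+1 then sigma m else k) => -[//|n].
  by rewrite mkseqSl; exact: Kx.
exists (sigma 0%N) => //; rewrite (KfP _).2.
by exists (sigma \o S) => n; have := Kx n.+1; rewrite mkseqSl.
Qed.

(** One branch carries certificates for all the sets at once: the certificate for
the [k]-th set is read at the positions [pickle (k, i)]. The set attached to a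
finite sequence imposes every condition whose positions it already covers, so
it is an intersection of closed sets. *)
Lemma bigcap_analytic (A_ : nat -> set R) :
  (forall k, analytic (A_ k)) -> analytic (\bigcap_k A_ k).
Proof.
move=> aA.
have /choice[Kf KfP] : forall k, exists K, (forall s, closed (K s)) /\ A_ k = suslin K.
  by move=> k; have [K] := aA k; exists K.
pose pr (k i : nat) : nat := pickle (k, i).
pose K s : set R := \bigcap_(kn in [set kn : nat * nat |
    forall i, (i < kn.2)%N -> (pr kn.1 i < size s)%N])
  Kf kn.1 (mkseq (fun i => nth 0%N s (pr kn.1 i)) kn.2).
exists K => [s|].
  by apply: closed_bigI => -[k n] _ /=; exact: (KfP k).1.
apply/seteqP; split => [x Ax|x [sigma Kx]].
  have /choice[sg sgP] : forall k, exists sigma : nat -> nat,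
      forall n, Kf k (mkseq sigma n) x.
    by move=> k; have := Ax k I; rewrite (KfP k).2.
  exists (fun j => if unpickle j is Some (k, i) then sg k i else 0%N) => m.
  move=> [k n] /= lt_m; have := sgP k n.
  congr (Kf k _ x); apply/eq_in_map => i; rewrite mem_iota add0n /= => lin.
  rewrite nth_mkseq; last by have := lt_m _ lin; rewrite size_mkseq.
  by rewrite pickleK.
move=> k _; rewrite (KfP k).2; exists (fun i => sigma (pr k i)) => n.
pose m := (\max_(i < n) (pr k i).+1)%N.
have lm i : (i < n)%N -> (pr k i < m)%N.
  by move=> lin; exact: (leq_bigmax (Ordinal lin)).
have := Kx m (k, n); rewrite /= size_mkseq => /(_ lm).
congr (Kf k _ x); apply/eq_in_map => i; rewrite mem_iota add0n /= => lin.
by rewrite nth_mkseq// lm.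
Qed.

(** Suslin sets are not closed under complement, so the induction over the Borel
sigma-algebra needs both a set and its complement. *)
Definition bianalytic A : Prop := analytic A /\ analytic (~` A).

Lemma measurable_analytic (A : set (measurableTypeR R)) :
  measurable A -> analytic A.
Proof.
suff : measurable `<=` bianalytic by move=> h /h[].
rewrite [measurable](_ : _ = (@RGenOInfty.G R).-sigma.-measurable); last first.
  exact: RGenOInfty.measurableE.
apply: smallest_sub; last first.
  move=> _ [x ->]; split; last by rewrite setCitvr; apply: closed_analytic; exact: interval_closed.
  rewrite itvoyEbigcup; apply: bigcup_analytic => k.
  by apply: closed_analytic; exact: interval_closed.
split => [||A_ bA].
- split; rewrite ?setC0; apply: closed_analytic; [exact: closed0|exact: closedT].
- by move=> B [aB aCB]; rewrite setTD; split; rewrite ?setCK.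
- split; first by apply: bigcup_analytic => k; case: (bA k).
  by rewrite setC_bigcup; apply: bigcap_analytic => k; case: (bA k).
Qed.

End analytic_sets.

(** * Uncountable Suslin sets contain a copy of the Cantor space *)

Section perfect.
Context {R : realType}.
Implicit Types (A B J : set R) (K : seq nat -> set R) (s : seq nat).

Definition outside_itv (ab : rat * rat) : set R := ~` `]ratr ab.1, ratr ab.2[%classic.

(** A scheme of closed sets is determined by a subset of a countable type: a
closed set is the intersection of the complements of the rational intervals
that it avoids. Hence Suslin sets are parametrised by the Cantor space. *)
Definition suslin_decode (c : set (seq nat * (rat * rat))) : set R :=
  suslin (fun s => \bigcap_(ab in [set ab | c (s, ab)]) outside_itv ab).

Lemma analytic_decode A : analytic A -> exists c, A = suslin_decode c.
Proof.
move=> [K cK ->]; exists [set sab | K sab.1 `<=` outside_itv sab.2].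
congr suslin; apply/funext => s; apply/seteqP; split => [x Kx ab /= KI|x /= Kx].
  exact: KI.
apply: contrapT => nKx.
have /(_ x nKx) : open (~` K s) by rewrite openC; exact: cK.
rewrite -nbhs_ballE => -[e /= e0 xe].
have [a] := @rat_in_itvoo R (x - e) x ltac:(by rewrite gtrBl).
have [b] := @rat_in_itvoo R x (x + e) ltac:(by rewrite ltrDl).
rewrite !in_itv /= => /andP[xb be] /andP[ea ax].
have /(_ _) : ~ outside_itv (a, b) x.
  by move=> H; apply: H; apply/andP; split; rewrite bnd_simp.
apply; apply: Kx => y Ky /= /andP[]; rewrite !bnd_simp => ay yb.
suff : (~` K s) y by [].
by apply: xe; rewrite /ball/= distrC; rewrite ltr_distl; apply/andP; split;
  [apply: lt_trans ay|apply: lt_trans be].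
Qed.

(** Discard from [B] the points that lie in a countable left part or in a
countable right part cut at a rational. This discards a countable set, so two
points remain, and rational cuts between them leave uncountable parts on both
sides. *)
Lemma uncountable_splits B : ~ countable B -> exists c c' : R,
  [/\ c < c', ~ countable (B `&` `]-oo, c]) & ~ countable (B `&` `[c', +oo[)].
Proof.
move=> uB.
pose lo := \bigcup_(c in [set c : rat | countable (B `&` `]-oo, ratr c])])
  (B `&` `]-oo, ratr c]).
pose hi := \bigcup_(c in [set c : rat | countable (B `&` `[ratr c, +oo[)])
  (B `&` `[ratr c, +oo[).
have clo : countable lo by apply: bigcup_countable => //; exact: countableP.
have chi : countable hi by apply: bigcup_countable => //; exact: countableP.
pose B' := B `\` (lo `|` hi).
have uB' : ~ countable B'.
  move=> cB'; apply: uB.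
  apply: (@sub_countable _ _ _
    (\bigcup_i (if i is i'.+1 then if i' is 0%N then lo else hi else B'))).
    apply: subset_card_le => x Bx.
    have [?|nlo] := pselect (lo x); first by exists 1%N.
    have [?|nhi] := pselect (hi x); first by exists 2%N.
    by exists 0%N => //; split => // -[].
  by apply: bigcup_countable => [|[|[|]]//]; exact: countableP.
have [x [Bx nx]] : B' !=set0.
  by apply/set0P/eqP => B0; apply: uB'; rewrite B0; exact: countable0.
have [y [[By ny] yx]] : (B' `\` [set x]) !=set0.
  apply/set0P/eqP => B0; apply: uB'.
  apply: (@sub_countable _ _ _ [set x]); last exact: finite_set_countable.
  apply: subset_card_le => z Bz; apply: contrapT => zx.
  by have : (B' `\` [set x]) z by []; rewrite B0.
wlog xy : x y Bx nx By ny yx / x < y.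
  move=> wl; have [xy|xy|/esym//] := ltgtP x y; first exact: (wl x y).
  by apply: (wl y x) => // /esym.
have [c] := @rat_in_itvoo R _ _ xy; rewrite in_itv/= => /andP[xc cy].
have [c'] := @rat_in_itvoo R _ _ cy; rewrite in_itv/= => /andP[cc' cy'].
exists (ratr c), (ratr c'); split => //.
  by move=> cc; apply: nx; left; exists c => //; split => //=; rewrite in_itv/= ltW.
by move=> cc; apply: ny; right; exists c' => //; split => //=; rewrite in_itv/= andbT ltW.
Qed.

Definition suslin_from K s : set R := [set x | exists2 sigma : nat -> nat,
  mkseq sigma (size s) = s & forall n, K (mkseq sigma n) x].

(** The inductive step of the Cantor scheme: an uncountable piece has two disjoint
uncountable closed subpieces, each with its certifying sequence one entry
longer. *)
Lemma suslin_from_split K s J : closed J -> ~ countable (suslin_from K s `&` J) ->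
  exists sJ : bool -> nat * set R,
    [/\ forall b, closed (sJ b).2 /\ (sJ b).2 `<=` J,
        forall b, ~ countable (suslin_from K (rcons s (sJ b).1) `&` (sJ b).2) &
        (sJ true).2 `&` (sJ false).2 = set0].
Proof.
move=> cJ /uncountable_splits[c [c' [cc' ulo uhi]]].
have step I : ~ countable (suslin_from K s `&` J `&` I) ->
    exists k, ~ countable (suslin_from K (rcons s k) `&` (J `&` I)).
  move=> uI; apply/existsNP => call; apply: uI.
  apply: (@sub_countable _ _ _
      (\bigcup_k (suslin_from K (rcons s k) `&` (J `&` I)))).
    apply: subset_card_le => x [[[sigma sE Kx] Jx] Ix].
    exists (sigma (size s)) => //; split => //; exists sigma => //.
    by rewrite size_rcons mkseqS sE.
  by apply: bigcup_countable => // k _; exact: call.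
have [k uk] := step _ ulo; have [k' uk'] := step _ uhi.
exists (fun b => if b then (k, J `&` `]-oo, c]) else (k', J `&` `[c', +oo[)).
split.
- by move=> []/=; split; [apply: closedI => //; exact: interval_closed|apply: subIsetl|
    apply: closedI => //; exact: interval_closed|apply: subIsetl].
- by case.
- rewrite -subset0 => x [[_ /= xc] [_ /=]].
  move: xc; rewrite !in_itv/= andbT => xc c'x.
  by have := lt_le_trans cc' (le_trans c'x xc); rewrite ltxx.
Qed.

(** Iterating the splitting along [beta] gives nested nonempty compact pieces; a
point of their intersection is certified by the sequences met on the way, and
distinct [beta] end up in disjoint pieces. *)
Lemma analytic_uncountable_injection A : analytic A -> ~ countable A ->
  exists e : (nat -> bool) -> R, injective e /\ forall beta, A (e beta).
Proof.
move=> [K cK ->] uA.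
have [N uN] : exists N : nat, ~ countable (suslin_from K [::] `&` `[- N%:R, N%:R]).
  apply/existsNP => call; apply: uA.
  apply: (@sub_countable _ _ _
      (\bigcup_N (suslin_from K [::] `&` `[- N%:R, N%:R]))).
    apply: subset_card_le => x [sigma Kx].
    exists (Num.truncn `|x|).+1 => //; split; first by exists sigma.
    by rewrite /= in_itv/= -ler_norml ltW// truncnS_gt.
  by apply: bigcup_countable => // k _; exact: call.
pose node := (seq nat * set R)%type.
pose good (v : node) := closed v.2 /\ ~ countable (suslin_from K v.1 `&` v.2).
have /choice[step stepP] : forall v : node, exists sJ : bool -> nat * set R,
    good v ->
    [/\ forall b, closed (sJ b).2 /\ (sJ b).2 `<=` v.2,
        forall b, ~ countable (suslin_from K (rcons v.1 (sJ b).1) `&` (sJ b).2) &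
        (sJ true).2 `&` (sJ false).2 = set0].
  move=> v; have [gv|] := pselect (good v); last by exists (fun=> (0%N, set0)).
  by have [sJ ?] := suslin_from_split gv.1 gv.2; exists sJ.
pose next (v : node) b : node := (rcons v.1 (step v b).1, (step v b).2).
pose fix branch (beta : nat -> bool) n : node :=
  if n is m.+1 then next (branch beta m) (beta m) else ([::], `[- N%:R, N%:R]%classic).
have gb beta n : good (branch beta n).
  elim: n => [|n IHn]; first by split => //; exact: interval_closed.
  by have [/(_ (beta n))[? _] /(_ (beta n)) ?] := stepP _ IHn; split.
have sizeb beta n : size (branch beta n).1 = n.
  by elim: n => // n IHn; rewrite /= size_rcons IHn.
have decr beta m n : (m <= n)%N -> (branch beta n).2 `<=` (branch beta m).2.
  elim: n => [|n IHn]; first by rewrite leqn0 => /eqP ->.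
  rewrite leq_eqVlt => /predU1P[->//|/IHn]; apply: subset_trans.
  by have [/(_ (beta n))[]] := stepP _ (gb beta n).
pose sg beta n := (step (branch beta n) (beta n)).1.
have branch1 beta n : (branch beta n).1 = mkseq (sg beta) n.
  by elim: n => // n IHn; rewrite mkseqS -IHn.
have pt beta n : exists x, (branch beta n).2 x /\
    forall m, (m <= n)%N -> K (mkseq (sg beta) m) x.
  have [cn un] := gb beta n.
  have [x [[sigma sE Kx] Jx]] : suslin_from K (branch beta n).1 `&` (branch beta n).2 !=set0.
    by apply/set0P/eqP => B0; apply: un; rewrite B0; exact: countable0.
  exists x; split => // m mn.
  suff -> : mkseq (sg beta) m = mkseq sigma m by [].
  have := congr1 (take m) sE; rewrite branch1 size_mkseq.
  by rewrite /mkseq -!map_take !take_iota (minn_idPl mn).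
have lim beta : exists x, forall n, (branch beta n).2 x /\ K (mkseq (sg beta) n) x.
  have /choice[u uP] := pt beta.
  have u0 : \forall n \near \oo, (`[- N%:R, N%:R]%classic : set R) (u n).
    by apply: nearW => n; have [+ _] := uP n; exact: (@decr beta 0%N).
  have [x [_ xu]] := @segment_compact R (- N%:R) N%:R (u @ \oo) _ u0.
  have clu (C : set R) n : closed C -> (forall m, (n <= m)%N -> C (u m)) -> C x.
    move=> cC Cu; apply: cC => B xB; apply: xu xB.
    by exists n => //= m; exact: Cu.
  exists x => n; split; (apply: (@clu _ n) => [|m nm]).
  - exact: (gb beta n).1.
  - by have [+ _] := uP m; exact: decr.
  - exact: cK.
  - by have [_] := uP m; exact.
have /choice[e eP] := lim.
exists e; split.
  move=> beta beta' ee.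
  (* Where two branches first part, their pieces are disjoint. *)
  have agree n : branch beta n = branch beta' n -> beta n = beta' n.
    move=> bb; have [_ _ disj] := stepP _ (gb beta n).
    have /= [+ _] := eP beta n.+1; have /= [+ _] := eP beta' n.+1.
    rewrite -ee -bb; case: (beta n) (beta' n) => -[]//= e1 e2.
      by have : set0 (e beta) by rewrite -disj.
    by have : set0 (e beta) by rewrite -disj.
  apply/funext => n; apply: (agree n).
  by elim: n => //= n IHn; rewrite IHn agree.
by move=> beta; exists (sg beta) => n; have [] := eP beta n.
Qed.

End perfect.

(** * Borel maps from the line to a metric space *)

Section simpson.
Context {R : realType}.

(** A Borel set that contains a copy of the Cantor space has more subsets than
there are Borel sets. The subset is the diagonal one: send each code [c] to a
point of [T] and keep that point when the set coded by [c] misses it. *)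
Lemma uncountable_has_nonmeasurable (T : set (measurableTypeR R)) :
  measurable T -> ~ countable T -> exists2 S, S `<=` T & ~ measurable S.
Proof.
move=> mT uT.
have [e [e_inj eT]] := analytic_uncountable_injection (measurable_analytic mT) uT.
pose enc (c : set (seq nat * (rat * rat))) (n : nat) : bool :=
  if unpickle n is Some x then `[< c x >] else false.
have enc_inj : injective enc.
  move=> c c' cc'; apply/predeqP => x.
  have := congr1 (@^~ (pickle x)) cc'; rewrite /enc pickleK => cc.
  exact: asbool_eq_equiv cc.
exists [set x | exists2 c, x = e (enc c) & ~ suslin_decode c x].
  by move=> _ [c -> _]; exact: eT.
move=> /measurable_analytic/analytic_decode[c0 c0E].
have iff0 : suslin_decode c0 (e (enc c0)) <-> ~ suslin_decode c0 (e (enc c0)).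
  split; last by move=> n0; rewrite -c0E; exists c0.
  by rewrite -{1}c0E => -[c /e_inj/enc_inj <-].
have n0 : ~ suslin_decode c0 (e (enc c0)) by move=> d0; exact: (iff0.1 d0 d0).
exact: n0 (iff0.2 n0).
Qed.

Context {E : completeMetricType R}.
Implicit Types (f g : R -> borel E).

Lemma measurable_open (U : set E) : open U -> measurable (U : set (borel E)).
Proof. by move=> oU; apply: sub_sigma_algebra. Qed.

(** All subsets of a separated set are closed, hence Borel; this is what makes a
large separated set in the range of a Borel map contradictory. *)
Lemma separated_closed (S : set E) (eps : R) : 0 < eps ->
  (forall u v, S u -> S v -> mdist u v < eps -> u = v) -> closed S.
Proof.
move=> e0 sepS x clx.
have [s [Ss]] := clx _ (nbhsx_ballx x _ (divr_gt0 e0 (@ltr0n R 2))).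
rewrite ballEmdist/= => xs.
have [->//|sx] := eqVneq x s.
have xs0 : 0 < mdist x s by rewrite mdist_gt0.
have [s' [Ss']] := clx _ (nbhsx_ballx x _ xs0).
rewrite ballEmdist/= => xs'.
suff ss : s' = s by rewrite ss ltxx in xs'.
apply: sepS => //; apply: le_lt_trans (metric_triangle _ x _) _.
by rewrite (splitr eps) ltrD// metric_sym (lt_trans xs').
Qed.

Lemma maximal_separated (A : set E) (eps : R) : 0 < eps -> exists D : set E,
  [/\ D `<=` A, forall u v, D u -> D v -> mdist u v < eps -> u = v &
      forall u, A u -> exists2 v, D v & mdist u v < eps].
Proof.
move=> e0.
pose P (D : set E) := D `<=` A /\ forall u v, D u -> D v -> mdist u v < eps -> u = v.
have [D [[DA sepD] maxD]] : exists D, P D /\ forall D', D `<` D' -> ~ P D'.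
  apply: Zorn_bigcup => F FP tF; split.
    by move=> x [D FD Dx]; exact: (FP _ FD).1.
  move=> u v [D FD Du] [D' FD' D'v].
  have [DD|DD] := tF _ _ FD FD'.
    by apply: (FP _ FD').2 => //; exact: DD.
  by apply: (FP _ FD).2 => //; exact: DD.
exists D; split => // u Au; apply: contrapT => nu.
have nDu : ~ D u.
  by move=> Du; apply: nu; exists u => //; rewrite mdistxx.
apply: (maxD (D `|` [set u])).
  split; first exact: subsetUl.
  by move=> /(_ u) h; apply: nDu; apply: h; right.
split; first by move=> x [/DA//|->].
have nn v : D v -> ~ mdist u v < eps by move=> Dv uv; apply: nu; exists v.
move=> a b [Da|->] [Db|->]//.
- exact: sepD.
- by rewrite metric_sym => /nn; exact.
- by move/nn; exact.
Qed.

(** Choose a preimage [rep d] of each [d] in [D]. Every union of fibres over [D] is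
Borel, so [rep \o f] is a Borel map and its fixed points form a Borel set [T],
which meets each fibre over [D] in exactly one point. Then every subset of [T]
is Borel as well, which forces [T], and with it [D], to be countable. *)
Lemma separated_range_countable f (D : set E) (eps : R) : 0 < eps ->
  measurable_fun [set: R] f -> D `<=` range f ->
  (forall u v, D u -> D v -> mdist u v < eps -> u = v) -> countable D.
Proof.
move=> e0 mf Df sepD; apply: contrapT => uD.
have mD (S : set E) : S `<=` D -> measurable (f @^-1` S).
  move=> SD; rewrite -[X in measurable X]setTI; apply: mf => //.
  rewrite -[S]setCK; apply: measurableC; apply: measurable_open.
  by rewrite openC; apply: (separated_closed e0) => u v /SD Du /SD Dv; exact: sepD.
have /choice[rep repP] : forall d, exists t, D d -> f t = d.
  by move=> d; have [/Df[t _ <-]|nD] := pselect (D d); [exists t|exists 0].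
(* Off the fibres over [D] the value is immaterial: [T] is cut out below. *)
pose h t := if f t \in D then rep (f t) else t.
have mh : measurable_fun [set: R] (h : R -> measurableTypeR R).
  move=> _ V mV; rewrite setTI.
  rewrite (_ : h @^-1` V = (f @^-1` [set d | D d /\ V (rep d)]) `|` (~` (f @^-1` D) `&` V)).
    apply: measurableU; first by apply: mD => d [].
    by apply: measurableI => //; apply: measurableC; exact: mD.
  apply/seteqP; split => t; rewrite /h/=; case: ifPn; rewrite ?inE ?notin_setE.
  - by move=> Dt Vt; left.
  - by move=> Dt Vt; right.
  - by move=> Dt [[]//|[]].
  - by move=> Dt [[]//|[]].
pose T : set R := (f @^-1` D) `&` [set t | h t = t].
have repT d : D d -> T (rep d).
  by move=> Dd; rewrite /T /h/= repP// ifT// inE.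
have mT : measurable (T : set (measurableTypeR R)).
  apply: measurableI; first exact: mD.
  rewrite (_ : [set t | h t = t] = [set: R] `&` (h \- id) @^-1` [set 0]).
    apply: (measurable_funB mh (@measurable_id _ _ _)) => //.
  rewrite setTI; apply/seteqP; split => t /=; first by move=> ->; rewrite subrr.
  by move=> /eqP; rewrite subr_eq0 => /eqP.
have [|S ST nS] := uncountable_has_nonmeasurable mT.
  move=> cT; apply: uD; apply: (@sub_countable _ _ _ (f @` T)).
    by apply: subset_card_le => d Dd; exists (rep d); [exact: repT|exact: repP].
  by apply: sub_countable cT; exact: card_image_le.
apply: nS; rewrite (_ : S = T `&` f @^-1` (f @` S)).
  apply: measurableI => //; apply: mD => _ [s /ST[Ds _] <-] //.
apply/seteqP; split => [s Ss|t [[Dt ht] [s Ss fst]]]; first by split; [exact: ST|exists s].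
have [Ds hs] := ST _ Ss.
suff -> : t = s by [].
by rewrite -ht -[RHS]hs /h fst !ifT// inE.
Qed.

(** Simpson's theorem. In a space of arbitrary weight it is what makes the integrals
of [mdist (f t) (g t)] obey the usual rules. *)
Lemma measurable_range_separable f : measurable_fun [set: R] f ->
  exists e : nat -> E, forall t (eps : R), 0 < eps -> exists n, mdist (f t : E) (e n) < eps.
Proof.
move=> mf.
have /choice[D DP] : forall k : nat, exists D : set E, countable D /\
    forall t, exists2 v, D v & mdist (f t : E) v < k.+1%:R^-1.
  move=> k; have k0 : 0 < k.+1%:R^-1 :> R by rewrite invr_gt0.
  have [D [Df sepD maxD]] := maximal_separated (range f) k0.
  exists D; split; first exact: (separated_range_countable k0 mf Df sepD).
  by move=> t; have [|v Dv tv] := maxD (f t); [exists t|exists v].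
have [e eP] : exists e : nat -> E, \bigcup_k D k `<=` range e.
  have /pcard_surjP : countable (\bigcup_k D k).
    by apply: bigcup_countable => [|k _]; [exact: countableP|exact: (DP k).1].
  by move=> [e eP]; exists e.
exists e => t eps eps0.
have [k kP] : exists k : nat, k.+1%:R^-1 < eps.
  by have [k _ /(_ k (leqnn k))] := near_infty_natSinv_lt (PosNum eps0); exists k.
have [v Dv tv] := (DP k).2 t.
have [|n _ nv] := eP v; first by exists k.
by exists n; rewrite nv (lt_trans tv).
Qed.

Lemma measurable_mdist_cst f (x : E) : measurable_fun [set: R] f ->
  measurable_fun [set: R] (fun t => mdist (f t : E) x : R).
Proof.
move=> mf; apply: (measurability _ (RGenInftyO.measurableE R)).
move=> _ [_ [r ->] <-]; rewrite setTI.
rewrite (_ : _ @^-1` _ = f @^-1` (ball x r)).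
  rewrite -[X in measurable X]setTI; apply: mf => //; apply: measurable_open.
  rewrite openE => y; rewrite ballEmdist /= /interior => xy; rewrite -nbhs_ballE.
  exists (r - mdist x y); first by rewrite /= subr_gt0.
  move=> z; rewrite !ballEmdist /= ltrBrDl; apply: le_lt_trans.
  exact: metric_triangle.
by rewrite ballEmdist; apply/seteqP; split => t /=; rewrite in_itv/= metric_sym.
Qed.

(** With a sequence [e] dense in the range of [f] and [u] in that range, [mdist u v < r]
holds if and only if [mdist u (e n) + mdist v (e n) < r] for some [n]. *)
Lemma measurable_mdist f g :
  measurable_fun [set: R] f -> measurable_fun [set: R] g ->
  measurable_fun [set: R] (fun t => mdist (f t : E) (g t) : R).
Proof.
move=> mf mg; have [e eP] := measurable_range_separable mf.
apply: (measurability _ (RGenInftyO.measurableE R)).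
move=> _ [_ [r ->] <-]; rewrite setTI.
rewrite (_ : _ @^-1` _ = \bigcup_n
    (fun t => mdist (f t : E) (e n) + mdist (g t : E) (e n)) @^-1` `]-oo, r[).
  apply: bigcup_measurable => n _; rewrite -[X in measurable X]setTI.
  by apply: measurable_funD => //; exact: measurable_mdist_cst.
apply/seteqP; split => t /=; rewrite in_itv/=.
  move=> fgr.
  have [n nP] := eP t ((r - mdist (f t : E) (g t)) / 2) ltac:(by rewrite divr_gt0// subr_gt0).
  exists n => //=; rewrite in_itv/=.
  have := metric_triangle (g t : E) (f t) (e n).
  rewrite (metric_sym (g t : E) (f t)) => gen.
  by lra.
move=> [n _ /=]; rewrite in_itv/=; apply: le_lt_trans.
by rewrite (metric_sym (g t : E)); exact: metric_triangle.
Qed.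

End simpson.

(** * Integral norms of nonnegative measurable functions *)

Section window_norm.
Context {R : realType}.
Notation leb := (@lebesgue_measure R).
Implicit Types (p q r : R) (A B : set R) (phi psi : R -> R).

Definition nnmeas phi := measurable_fun [set: R] phi /\ forall t, 0 <= phi t.

Lemma nnmeasD phi psi : nnmeas phi -> nnmeas psi -> nnmeas (fun t => phi t + psi t).
Proof.
by move=> [mf f0] [mg g0]; split; [exact: measurable_funD|move=> t; exact: addr_ge0].
Qed.

Lemma nnmeasM phi psi : nnmeas phi -> nnmeas psi -> nnmeas (fun t => phi t * psi t).
Proof.
by move=> [mf f0] [mg g0]; split; [exact: measurable_funM|move=> t; exact: mulr_ge0].
Qed.

Lemma nnmeas_cst (c : R) : 0 <= c -> nnmeas (fun=> c).
Proof. by move=> c0; split. Qed.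

Lemma nnmeas_sum (n : nat) (f : nat -> R -> R) : (forall i, nnmeas (f i)) ->
  nnmeas (fun t => \sum_(i < n) f i t).
Proof.
move=> mf; split; last by move=> t; apply: sumr_ge0 => i _; exact: (mf i).2.
by apply: measurable_sum => i; exact: (mf i).1.
Qed.

Lemma measurable_shift (c : R) :
  measurable_fun [set: R] ((fun t => t + c) : R -> R).
Proof. exact: measurable_funD. Qed.

Lemma nnmeas_shift phi (c : R) : nnmeas phi -> nnmeas (fun t => phi (t + c)).
Proof.
move=> [mf f0]; split => //.
exact: (measurableT_comp mf (measurable_shift c)).
Qed.

Lemma nnmeas_powR phi p : nnmeas phi -> nnmeas (fun t => phi t `^ p).
Proof.
move=> [mf f0]; split; last by move=> t; exact: powR_ge0.
exact: (@measurableT_comp _ _ _ _ _ _ (@powR R ^~ p)).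
Qed.

Lemma nnmeas_EFin phi A : nnmeas phi -> measurable_fun A (fun t => (phi t)%:E).
Proof. by move=> [mf _]; apply/measurable_EFinP; exact: measurable_funTS. Qed.

(** The norm of [L^p(A)]. It is meant for nonnegative functions, and the windows [A]
of interest are the unit intervals [[x, x + 1]]: the Stepanov norm is the
supremum over these, and the norm of the Bochner transform at [x] is one of
them. *)
Definition wnorm p A phi : \bar R :=
  ((\int[leb]_(t in A) ((phi t) `^ p)%:E) `^ p^-1)%E.

Lemma eq_wnorm p A phi psi : (forall t, A t -> phi t = psi t) ->
  wnorm p A phi = wnorm p A psi.
Proof.
move=> eq_phi; apply: (congr1 (fun z => z `^ p^-1)%E).
by apply: eq_integral => t /set_mem At; rewrite eq_phi.
Qed.

Lemma wnorm_ge0 p A phi : (0 <= wnorm p A phi)%E.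
Proof. exact: poweR_ge0. Qed.

Lemma ge0_le_poweR (x y : \bar R) p : 0 <= p -> (0 <= x)%E -> (x <= y)%E ->
  (x `^ p <= y `^ p)%E.
Proof.
move=> p0 x0 xy; apply: gt0_ler_poweR => //; rewrite in_itv/= leey andbT//.
exact: le_trans xy.
Qed.

Lemma integral_powR_ge0 p A phi : (0 <= \int[leb]_(t in A) ((phi t) `^ p)%:E)%E.
Proof. by apply: integral_ge0 => t _; rewrite lee_fin powR_ge0. Qed.

Lemma le_wnorm p A phi psi : 0 <= p -> measurable A -> nnmeas phi -> nnmeas psi ->
  (forall t, A t -> phi t <= psi t) -> (wnorm p A phi <= wnorm p A psi)%E.
Proof.
move=> p0 mA mphi mpsi le; apply: ge0_le_poweR; rewrite ?invr_ge0//.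
  exact: integral_powR_ge0.
apply: ge0_le_integral => //.
- by move=> t _; rewrite lee_fin powR_ge0.
- by apply: nnmeas_EFin; exact: nnmeas_powR.
- by apply: nnmeas_EFin; exact: nnmeas_powR.
- move=> t At; rewrite lee_fin; apply: ge0_ler_powR; rewrite ?nnegrE//; last exact: le.
    exact: mphi.2.
  exact: mpsi.2.
Qed.

Lemma wnorm_subset p A B phi : 0 <= p -> measurable A -> measurable B ->
  nnmeas phi -> A `<=` B -> (wnorm p A phi <= wnorm p B phi)%E.
Proof.
move=> p0 mA mB mphi AB; apply: ge0_le_poweR; rewrite ?invr_ge0//.
  exact: integral_powR_ge0.
apply: ge0_subset_integral => //.
- by apply: nnmeas_EFin; exact: nnmeas_powR.
- by move=> t _; rewrite lee_fin powR_ge0.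
Qed.

(** Extension by zero turns the norm on [A] into a norm on the whole line, where the
inequalities of Minkowski and Hoelder apply. *)
Lemma wnormE p A phi : 0 < p -> (forall t, 0 <= phi t) ->
  wnorm p A phi = Lnorm leb p%:E (EFin \o (phi \_ A)).
Proof.
move=> p0 phi0; rewrite unlock; apply: (congr1 (fun z => z `^ p^-1)%E).
rewrite [LHS]integral_mkcond.
apply: eq_integral => t _; rewrite /patch/=; case: ifPn => _.
  by rewrite ger0_norm.
by rewrite (_ : point = 0)// normr0 powR0// gt_eqF.
Qed.

Lemma nnmeas_restrict phi A : measurable A -> nnmeas phi -> nnmeas (phi \_ A).
Proof.
move=> mA [mf f0]; split.
  exact: (measurable_restrictT phi mA).1 (measurable_funTS mf).
by move=> t; rewrite /patch; case: ifPn.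
Qed.

Lemma wnormD p A phi psi : 1 <= p -> measurable A -> nnmeas phi -> nnmeas psi ->
  (wnorm p A (fun t => phi t + psi t)%R <= wnorm p A phi + wnorm p A psi)%E.
Proof.
move=> p1 mA mphi mpsi.
have p0 : 0 < p by exact: lt_le_trans p1.
rewrite !wnormE//; [|exact: mpsi.2|exact: mphi.2|by move=> t; rewrite addr_ge0// ?mphi.2 ?mpsi.2].
have := @minkowski_EFin _ _ _ leb (phi \_ A) (psi \_ A) p
  (nnmeas_restrict mA mphi).1 (nnmeas_restrict mA mpsi).1 p1.
congr (_ <= _)%E; congr Lnorm; apply/funext => t /=; congr EFin.
by rewrite /patch; case: ifPn => // _; rewrite addr0.
Qed.

Lemma wnorm_sum p A (n : nat) (f : nat -> R -> R) : 1 <= p -> measurable A ->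
  (forall i, nnmeas (f i)) ->
  (wnorm p A (fun t => \sum_(i < n) f i t)%R <= \sum_(i < n) wnorm p A (f i))%E.
Proof.
move=> p1 mA mf; have p0 : 0 < p by exact: lt_le_trans p1.
elim: n => [|n IHn].
  rewrite big_ord0 /wnorm; under eq_integral do rewrite big_ord0 powR0 ?gt_eqF//.
  by rewrite integral0 poweR0r// gt_eqF// invr_gt0.
rewrite big_ord_recr/=; under [X in wnorm _ _ X]eq_fun do rewrite big_ord_recr/=.
apply: le_trans (wnormD p1 mA (nnmeas_sum n mf) (mf n)) _.
exact: leeD2r.
Qed.

(** Hoelder's inequality with the exponents [r / p] and [q / p] for the functions
[phi ^ p] and [psi ^ p]. *)
Lemma wnormM p q r A phi psi : 1 <= p -> 1 <= q -> 1 <= r ->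
  p^-1 = q^-1 + r^-1 -> measurable A -> nnmeas phi -> nnmeas psi ->
  (wnorm p A (fun t => phi t * psi t)%R <= wnorm r A phi * wnorm q A psi)%E.
Proof.
move=> p1 q1 r1 pqr mA mphi mpsi.
have p0 : 0 < p by exact: lt_le_trans p1.
have q0 : 0 < q by exact: lt_le_trans q1.
have r0 : 0 < r by exact: lt_le_trans r1.
have := @hoelder _ _ _ leb ((fun t => phi t `^ p) \_ A) ((fun t => psi t `^ p) \_ A)
  (r / p) (q / p) (nnmeas_restrict mA (nnmeas_powR p mphi)).1
  (nnmeas_restrict mA (nnmeas_powR p mpsi)).1.
rewrite !divr_gt0// => /(_ isT isT).
rewrite !invf_div -mulrDr addrC -pqr divff ?gt_eqF// => /(_ erefl).
rewrite -!wnormE ?divr_gt0//; [|by move=> t; exact: powR_ge0..].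
have E (s : R) (f : R -> R) : 0 < s -> (wnorm (s / p) A (fun t => f t `^ p)%R =
    (wnorm s A f) `^ p)%E.
  move=> s0; rewrite /wnorm -poweRrM invf_div (mulrC s^-1 p).
  apply: (congr1 (fun z => z `^ (p / s))%E).
  by apply: eq_integral => t _; rewrite -powRrM mulrCA divff ?gt_eqF// mulr1.
rewrite !E// -poweRM ?wnorm_ge0//.
rewrite Lnorm1 => H.
rewrite {1}/wnorm.
rewrite [X in (X `^ _ <= _)%E](_ : _ = \int[leb]_x `|(EFin \o
  (((fun t => phi t `^ p) \_ A) \* ((fun t => psi t `^ p) \_ A))%R) x|)%E.
  apply: le_trans (ge0_le_poweR _ _ H) _.
  - by rewrite invr_ge0 ltW.
  - by apply: integral_ge0.
  - by rewrite -poweRrM divff ?gt_eqF// poweRe1// mule_ge0 ?wnorm_ge0.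
rewrite [LHS]integral_mkcond; apply: eq_integral => t _; rewrite /patch/=.
case: ifPn => _; last by rewrite mulr0 normr0.
by rewrite ger0_norm ?powRM ?mphi.2 ?mpsi.2// mulr_ge0// powR_ge0.
Qed.

Lemma lebesgue_measure_shift (c : R) (A : set R) : measurable A ->
  pushforward leb ((fun t => t + c) : R -> measurableTypeR R) A = leb A.
Proof.
move=> mA; apply/esym.
pose tr : measurableTypeR R -> measurableTypeR R := fun t => t + c.
have mc : measurable_fun [set: measurableTypeR R] tr by exact: measurable_shift.
pose mc_mixin := isMeasurableFun.Build _ _ _ _ _ mc.
pose f : {mfun measurableTypeR R >-> measurableTypeR R} := HB.pack tr mc_mixin.
apply: (@lebesgue_measure_unique _ (pushforward leb f)) => //= _ [[a b]] _ <-.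
rewrite /pushforward/= (_ : _ @^-1` _ = `]a - c, b - c]%classic); last first.
  by apply/seteqP; split => t /=; rewrite !in_itv/= ltrBlDr lerBrDr.
by rewrite !lebesgue_measure_itv/= !lte_fin ltrD2r -!EFinB opprB addrA subrK.
Qed.

Lemma wnorm_shift p (x y c : R) phi : nnmeas phi ->
  wnorm p `[x, y] (fun t => phi (t + c)) = wnorm p `[x + c, y + c] phi.
Proof.
move=> mphi; apply: (congr1 (fun z => z `^ p^-1)%E).
pose tr : R -> measurableTypeR R := fun t => t + c.
transitivity (\int[pushforward leb tr]_(t in `[(x + c)%R, (y + c)%R])
    ((phi t) `^ p)%:E)%E.
  rewrite ge0_integral_pushforward//.
  - congr integral; apply/seteqP; split => t /=; rewrite !in_itv/= !lerD2r//.
  - exact: measurable_shift.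
  - by apply: nnmeas_EFin; exact: nnmeas_powR.
  - by move=> t _; rewrite lee_fin powR_ge0.
apply: eq_measure_integral => [|mc B mB _]; first exact: measurable_shift.
exact: (lebesgue_measure_shift _ mB).
Qed.

Lemma wnorm_lty p A phi : 0 < p ->
  (wnorm p A phi < +oo <-> \int[leb]_(t in A) ((phi t) `^ p)%:E < +oo)%E.
Proof.
move=> p0; split; last exact: poweR_lty.
by apply: lty_poweRy; rewrite gt_eqF ?invr_gt0.
Qed.

End window_norm.

(** * Approximation by the nearest point of a finite net *)

Section nearest_point.
Context {R : realType} {E : completeMetricType R}.
Variable e : nat -> E.

(** Ties are broken in favour of the first index, so that the index depends
measurably on [u]. *)
Fixpoint nearest_index n (u : E) : nat :=
  if n is m.+1 then
    if mdist u (e n) < mdist u (e (nearest_index m u)) then n else nearest_index m u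
  else 0%N.

Definition net_dist n (u : E) : R := mdist u (e (nearest_index n u)).

Lemma nearest_index_le n u : (nearest_index n u <= n)%N.
Proof. by elim: n => //= n IHn; case: ifPn => // _; exact: leqW. Qed.

Lemma net_dist_le n u i : (i <= n)%N -> net_dist n u <= mdist u (e i).
Proof.
rewrite /net_dist; elim: n => [|n IHn]; first by rewrite leqn0 => /eqP ->.
rewrite leq_eqVlt => /predU1P[->|/IHn h] /=.
  by case: ltP.
by case: ifPn => // /ltW /le_trans; exact.
Qed.

Lemma net_dist_triangle n u v : net_dist n u <= mdist u v + net_dist n v.
Proof.
apply: le_trans (net_dist_le u (nearest_index_le n v)) _.
exact: metric_triangle.
Qed.

Lemma net_dist_ge0 n u : 0 <= net_dist n u.
Proof. exact: mdist_ge0. Qed.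

Variables (f : R -> borel E) (mf : measurable_fun [set: R] f).

Lemma nnmeas_mdist_cst (x : E) : nnmeas (fun t => mdist (f t : E) x).
Proof. by split => [|t]; [exact: measurable_mdist_cst|exact: mdist_ge0]. Qed.

Lemma measurable_nearest n :
  measurable_fun [set: R] (fun t => (nearest_index n (f t))%:R : R) /\
  measurable_fun [set: R] (fun t => net_dist n (f t) : R).
Proof.
elim: n => [|n [IH1 IH2]].
  by split; [exact: measurable_cst|exact: (measurable_mdist_cst (e 0%N) mf)].
have mlt : measurable_fun [set: R] (fun t =>
    mdist (f t : E) (e n.+1) < mdist (f t : E) (e (nearest_index n (f t)))).
  by apply: measurable_fun_ltr => //; exact: measurable_mdist_cst.
split.
  rewrite (_ : (fun t => _) = (fun t => if mdist (f t : E) (e n.+1) <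
      mdist (f t : E) (e (nearest_index n (f t))) then n.+1%:R else (nearest_index n (f t))%:R)).
    exact: measurable_fun_ifT.
  by apply/funext => t /=; case: ifPn.
rewrite (_ : (fun t => _) = (fun t => if mdist (f t : E) (e n.+1) <
      mdist (f t : E) (e (nearest_index n (f t))) then mdist (f t : E) (e n.+1)
      else net_dist n (f t))).
  by apply: measurable_fun_ifT => //; exact: measurable_mdist_cst.
by apply/funext => t /=; rewrite {1}/net_dist /=; case: ifPn.
Qed.

Lemma nnmeas_net_dist n : nnmeas (fun t => net_dist n (f t)).
Proof. by split; [exact: (measurable_nearest n).2|move=> t; exact: mdist_ge0]. Qed.

Hypothesis e_dense : forall t (eps : R), 0 < eps -> exists n, mdist (f t : E) (e n) < eps.

(** The distance to the net decreases to [0] pointwise and is dominated by the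
distance to [e 0]. *)
Lemma net_dist_cvg (p a b eps : R) : 1 <= p -> 0 < eps ->
  (wnorm p `[a, b] (fun t => mdist (f t : E) (e 0%N)) < +oo)%E ->
  exists n, (wnorm p `[a, b] (fun t => net_dist n (f t)) <= eps%:E)%E.
Proof.
move=> p1 eps0; have p0 : 0 < p by exact: lt_le_trans p1.
move=> /(wnorm_lty _ _ p0) fin0.
have mab : measurable (`[a, b]%classic : set (measurableTypeR R)) by [].
pose F n t := (net_dist n (f t) `^ p)%:E.
have mF n : measurable_fun `[a, b] (F n).
  by apply: nnmeas_EFin; apply: nnmeas_powR; exact: nnmeas_net_dist.
have cF t : `[a, b]%classic t -> F n t @[n --> \oo] --> (cst 0 t : \bar R).
  move=> _; apply: cvg_EFin; first exact: nearW.
  rewrite (_ : fine \o _ = (fun n => net_dist n (f t) `^ p))//.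
  apply/cvgrPdist_le => d d0.
  have [N NP] := @e_dense t (d `^ p^-1) ltac:(by rewrite powR_gt0).
  exists N => //= n /= Nn; rewrite sub0r normrN ger0_norm ?powR_ge0//.
  rewrite -[leRHS]powRr1 ?(ltW d0)// -(@mulVf _ p) ?gt_eqF// powRrM.
  apply: ge0_ler_powR; rewrite ?nnegrE ?powR_ge0 ?net_dist_ge0 ?(ltW p0)//.
  exact: le_trans (net_dist_le _ Nn) (ltW NP).
have iG : (@lebesgue_measure R).-integrable `[a, b] (fun t => (mdist (f t : E) (e 0%N) `^ p)%:E).
  apply/integrableP; split.
    by apply: nnmeas_EFin; apply: nnmeas_powR; exact: nnmeas_mdist_cst.
  apply: le_lt_trans fin0; rewrite le_eqVlt; apply/orP; left; apply/eqP.
  by apply: eq_integral => t _; rewrite gee0_abs// lee_fin powR_ge0.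
have dF n t : `[a, b]%classic t -> (`|F n t| <= (mdist (f t : E) (e 0%N) `^ p)%:E)%E.
  move=> _; rewrite gee0_abs ?lee_fin ?powR_ge0//.
  by apply: ge0_ler_powR; rewrite ?nnegrE ?mdist_ge0 ?(ltW p0)// net_dist_le.
have : (\int[@lebesgue_measure R]_(t in `[a, b]) F n t)%E @[n --> \oo] -->
    (\int[@lebesgue_measure R]_(t in `[a, b]) (cst 0 t))%E.
  exact: (dominated_cvg mab mF cF _ iG dF).
rewrite integral_cst//= mul0e => /fine_cvgP[fine_n cvg_n].
have /cvgrPdist_le/(_ (eps `^ p) (powR_gt0 p eps0)) small := cvg_n.
near \oo => n; exists n.
have le_n : (\int[@lebesgue_measure R]_(t in `[a, b]) F n t <= (eps `^ p)%:E)%E.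
  rewrite -(@fineK _ (\int[@lebesgue_measure R]_(t in `[a, b]) F n t)%E); last by near: n.
  rewrite lee_fin; apply: le_trans (ler_norm _) _.
  by rewrite -normrN -sub0r; near: n.
rewrite /wnorm.
apply: le_trans (ge0_le_poweR _ _ le_n) _; rewrite ?invr_ge0 ?(ltW p0)//.
  exact: integral_powR_ge0.
by rewrite poweR_EFin -powRrM divff ?gt_eqF// powRr1// ltW.
Unshelve. all: by end_near. Qed.

End nearest_point.

Section locally_integrable.
Context {R : realType} {E : completeMetricType R}.
Implicit Types (f : R -> E).

Lemma locally_integrable_wnorm (p : R) f (x : E) (a b : R) : 1 <= p ->
  locally_integrable_p p f ->
  (wnorm p `[a, b] (fun t => mdist (f t) x) < +oo)%E.
Proof.
move=> p1 [mf [x0 fx0]]; have p0 : 0 < p by exact: lt_le_trans p1.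
pose B := `[a, Num.max b (a + 1)]%classic.
have aB : a < Num.max b (a + 1) by rewrite lt_max ltrDl ltr01 orbT.
have sub : `[a, b] `<=` B.
  by apply: subset_itvl; rewrite bnd_simp le_max lexx.
have mB : measurable (B : set (measurableTypeR R)) by exact: measurable_itv.
apply: le_lt_trans (wnorm_subset (ltW p0) _ mB (nnmeas_mdist_cst mf x) sub) _ => //.
apply: (@le_lt_trans _ _ (wnorm p B (fun t => mdist (f t) x0 + mdist x0 x)%R)).
  apply: le_wnorm => //; first exact: ltW.
  - exact: nnmeas_mdist_cst.
  - by apply: nnmeasD; [exact: nnmeas_mdist_cst|exact/nnmeas_cst/mdist_ge0].
  - by move=> t _; exact: metric_triangle.
apply: le_lt_trans (wnormD p1 _ _ _) _ => //.
- exact: nnmeas_mdist_cst.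
- exact/nnmeas_cst/mdist_ge0.
apply: lte_add_pinfty; first by apply/(wnorm_lty _ _ p0); exact: fx0.
apply/(wnorm_lty _ _ p0); rewrite integral_cst//= lebesgue_measure_itv/=.
by rewrite lte_fin aB -EFinB -EFinM ltry.
Qed.

End locally_integrable.

(** * Continuity of translations in the mean *)

Section translation_continuity.
Context {R : realType}.
Notation leb := (@lebesgue_measure R).

Lemma wnorm1 A (phi : R -> R) : (forall t, 0 <= phi t) ->
  wnorm 1 A phi = (\int[leb]_(t in A) (phi t)%:E)%E.
Proof.
move=> phi0; rewrite /wnorm invr1 poweRe1; last exact: integral_powR_ge0.
by apply: eq_integral => t _; rewrite powRr1.
Qed.

(** Uniform continuity on a compact interval, where [t + h] may leave the interval. *)
Lemma continuous_translation (g : R -> R) (a b eps : R) : continuous g -> 0 < eps ->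
  exists2 eta : R, 0 < eta & forall h t, `|h| <= eta -> t \in `[a, b] -> `|g (t + h) - g t| <= eps.
Proof.
move=> cg e0.
have /compact_near_coveringP cov := @segment_compact R a b.
have := cov R (nbhs (0 : R)) (fun h t => `|g (t + h) - g t| <= eps) _.
case.
  move=> x _; have e2 : 0 < eps / 2 by rewrite divr_gt0.
  have /cvgrPdist_le/(_ _ e2) := cg x.
  move=> /nbhs_ballP[d /= d0 dP].
  exists (ball x (d / 2), ball (0 : R) (d / 2)).
    by split; apply: nbhsx_ballx; rewrite divr_gt0.
  move=> [t h] /= [xt h0].
  have gt : `|g x - g t| <= eps / 2.
    by apply: dP; apply: le_ball xt; rewrite ler_pdivrMr// ler_pMr// ler1n.
  have gth : `|g x - g (t + h)| <= eps / 2.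
    apply: dP; rewrite /ball/= opprD addrA (splitr d).
    move: xt h0; rewrite /ball/= sub0r normrN => xt h0.
    by apply: le_lt_trans (ler_normB _ _) _; exact: ltrD.
  rewrite (splitr eps) -(subrKA (g x)).
  apply: le_trans (ler_normD _ _) _.
  by rewrite distrC lerD.
move=> d /= d0 dP; exists (d / 2); first by rewrite divr_gt0.
move=> h t hd tab; apply: (dP h) => //=.
by rewrite sub0r normrN (le_lt_trans hd)// ltr_pdivrMr// ltr_pMr// ltr1n.
Qed.

(** Continuous functions are dense in [L^1] of a slightly larger interval, and
translations act continuously on them. *)
Lemma translation_continuity_L1 (k : R -> R) (M a b eps : R) :
  measurable_fun [set: R] k -> (forall t, `|k t| <= M) -> 0 < eps ->
  exists2 eta : R, 0 < eta & forall h, `|h| <= eta ->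
    (wnorm 1 `[a, b] (fun t => `|k (t + h) - k t|)%R <= eps%:E)%E.
Proof.
move=> mk kM e0.
pose K : set (measurableTypeR R) := `[a - 1, b + 1]%classic.
have mK : measurable K by exact: measurable_itv.
have Kfin : (leb K < +oo)%E.
  by rewrite /K lebesgue_measure_itv/=; case: ifP => _; rewrite ?ltry// -EFinB ltry.
have ik : leb.-integrable K (EFin \o k).
  apply: measurable_bounded_integrable => //; first exact: measurable_funTS.
  exists M; split; first exact: num_real.
  by move=> x Mx t _ /=; exact: le_trans (kM t) (ltW Mx).
have [g_ [cg _ gk]] := approximation_continuous_integrable mK Kfin ik.
have e3 : 0 < eps / 3 by rewrite divr_gt0.
have [n gn] : exists n, (\int[leb]_(z in K) `|(k z - g_ n z)%:E| <= (eps / 3)%:E)%E.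
  move/fine_cvgP : gk => [fine_n /cvgrPdist_le/(_ _ e3) small].
  near \oo => n; exists n.
  rewrite -[leLHS](@fineK _ _); last by near: n.
  rewrite lee_fin; apply: le_trans (ler_norm _) _.
  by rewrite -normrN -sub0r; near: n.
set g := g_ n in gn.
have mg : measurable_fun [set: R] g by exact: continuous_measurable_fun (cg n).
have nn (u v : R -> R) : measurable_fun [set: R] u -> measurable_fun [set: R] v ->
    nnmeas (fun t => `|u t - v t|).
  move=> mu mv; split => // .
  by apply: measurableT_comp => //; exact: measurable_funB.
have sh (u : R -> R) h : measurable_fun [set: R] u -> measurable_fun [set: R] (fun t => u (t + h)).
  by move=> mu; exact: (measurableT_comp mu (measurable_shift h)).
have gK : (wnorm 1 K (fun t => `|k t - g t|)%R <= (eps / 3)%:E)%E by rewrite wnorm1.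
pose c := `|b - a| + 1.
have c0 : 0 < c by rewrite ltr_wpDl.
have [eta eta0 etaP] := @continuous_translation g a b (eps / 3 / c) (cg n)
  ltac:(by rewrite divr_gt0).
(* With [|h| <= 1], translating by [h] keeps [[a, b]] inside [K]. *)
exists (Num.min eta 1); first by rewrite lt_min eta0 ltr01.
move=> h; rewrite le_min => /andP[heta h1].
have mab : measurable (`[a, b]%classic : set (measurableTypeR R)) by exact: measurable_itv.
apply: (@le_trans _ _ (wnorm 1 `[a, b] (fun t =>
    (`|k (t + h) - g (t + h)| + `|g (t + h) - g t|) + `|k t - g t|)%R)).
  apply: le_wnorm => //.
  - by apply: nn => //; exact: sh.
  - by apply: nnmeasD; [apply: nnmeasD|]; apply: nn => //; exact: sh.
  - move=> t _; rewrite -(subrKA (g t)) (distrC (k t)).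
    apply: le_trans (ler_normD _ _) _; rewrite lerD2r.
    by rewrite -(subrKA (g (t + h))); exact: ler_normD.
apply: le_trans (wnormD _ _ _ _) _ => //.
- by apply: nnmeasD; apply: nn => //; exact: sh.
- exact: nn.
rewrite (_ : eps = (eps / 3 + eps / 3) + eps / 3); last by lra.
rewrite 2!EFinD; apply: leeD; last first.
  apply: le_trans gK; apply: wnorm_subset => //; first exact: nn.
  by move=> t; rewrite /K/= !in_itv/= => /andP[at_ tb]; apply/andP; split; lra.
apply: le_trans (wnormD _ _ _ _) _ => //; [by apply: nn; exact: sh|by apply: nn => //; exact: sh|].
apply: leeD.
  rewrite (@wnorm_shift _ 1 a b h (fun t => `|k t - g t|)); last exact: nn.
  apply: le_trans gK; apply: wnorm_subset => //; first exact: nn.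
  move: h1; rewrite ler_norml => /andP[h1 h1'] t; rewrite /K/= !in_itv/= => /andP[at_ tb].
  by apply/andP; split; lra.
rewrite wnorm1//.
apply: (@le_trans _ _ (\int[leb]_(t in `[a, b]) (eps / 3 / c)%R%:E)%E).
  apply: ge0_le_integral => //.
  - by apply: nnmeas_EFin; apply: nn => //; exact: sh.
  - by move=> t tab; rewrite lee_fin; exact: etaP.
rewrite integral_cst//= lebesgue_measure_itv/=; case: ifPn => _; last first.
  by rewrite mule0 lee_fin ltW.
rewrite -EFinB -EFinM lee_fin mulrAC ler_pdivrMr// ler_pM2l//.
rewrite /c; have := ler_norm (b - a); lra.
Unshelve. all: by end_near. Qed.

Context {E : completeMetricType R}.

(** Up to a small error [f] takes finitely many values [e i], and then
[mdist (f (t + h)) (f t)] is controlled by the variation of the real function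
[k t], the index of the value: [mdist] is at most [M], and two distinct indices
differ by at least [1]. So the scalar case with exponent [1] suffices. *)
Lemma translation_continuity (p : R) (f : R -> E) (a b eps : R) :
  1 <= p -> locally_integrable_p p f -> 0 < eps ->
  exists2 eta : R, 0 < eta & forall h, `|h| <= eta ->
    (wnorm p `[a, b] (fun t => mdist (f (t + h)) (f t))%R <= eps%:E)%E.
Proof.
move=> p1 lf e0; have mf := lf.1; have p0 : 0 < p by exact: lt_le_trans p1.
have [e e_dense] := measurable_range_separable mf.
have e3 : 0 < eps / 3 by rewrite divr_gt0.
have mab : measurable (`[a, b]%classic : set (measurableTypeR R)) by exact: measurable_itv.
have mK : measurable (`[a - 1, b + 1]%classic : set (measurableTypeR R)) by exact: measurable_itv.
have [n nP] := net_dist_cvg mf e_dense p1 e3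
  (locally_integrable_wnorm (e 0%N) (a - 1) (b + 1) p1 lf).
pose M := 1 + \sum_(i < n.+1) \sum_(j < n.+1) mdist (e i) (e j).
have M0 : 0 < M.
  rewrite ltr_pwDl// sumr_ge0// => i _; rewrite sumr_ge0// => j _.
  exact: mdist_ge0.
have leM i j : (i <= n)%N -> (j <= n)%N -> mdist (e i) (e j) <= M.
  move=> lin ljn; rewrite /M (bigD1 (Ordinal (lin : (i < n.+1)%N)))//=.
  rewrite (bigD1 (Ordinal (ljn : (j < n.+1)%N)))//=.
  rewrite -[leLHS]add0r lerD// -[leLHS]addr0 lerD//.
    by rewrite lerDl sumr_ge0// => l _; exact: mdist_ge0.
  by rewrite sumr_ge0// => l _; rewrite sumr_ge0// => ? _; exact: mdist_ge0.
pose k t : R := (nearest_index e n (f t))%:R.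
have mk : measurable_fun [set: R] k by exact: (@measurable_nearest _ _ e f mf n).1.
have [eta eta0 etaP] := @translation_continuity_L1 k n%:R a b ((eps / 3 / M) `^ p) mk
  (fun t => ltac:(by rewrite ger0_norm// ler_nat nearest_index_le))
  ltac:(by rewrite powR_gt0// divr_gt0).
exists (Num.min eta 1); first by rewrite lt_min eta0 ltr01.
move=> h; rewrite le_min => /andP[heta h1].
(* The exponent [p^-1] makes the norm of [D] an integral of [|k (t + h) - k t|]. *)
pose D t := M * `|k (t + h) - k t| `^ p^-1.
have mkh : nnmeas (fun t => `|k (t + h) - k t|).
  split => //; apply: measurableT_comp => //; apply: measurable_funB => //.
  exact: (measurableT_comp mk (measurable_shift h)).
have mD : nnmeas D by apply: nnmeasM; [exact/nnmeas_cst/ltW|exact: nnmeas_powR].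
have mN := nnmeas_net_dist e mf n.
have mNh := nnmeas_shift h mN.
have mfh : measurable_fun [set: R] ((fun t => f (t + h)) : R -> borel E).
  exact: (measurableT_comp mf (measurable_shift h)).
apply: (@le_trans _ _ (wnorm p `[a, b] (fun t =>
    (net_dist e n (f (t + h)) + D t) + net_dist e n (f t))%R)).
  apply: le_wnorm => //; first exact: ltW.
  - by split => [|t]; [exact: measurable_mdist|exact: mdist_ge0].
  - by do 2 apply: nnmeasD => //.
  - move=> t _; apply: le_trans (metric_triangle _ (e (nearest_index e n (f t))) _) _.
    rewrite [X in _ + X]metric_sym lerD2r.
    apply: le_trans (metric_triangle _ (e (nearest_index e n (f (t + h)))) _) _.
    rewrite lerD2l /D /k.
    have [->|neq] := eqVneq (nearest_index e n (f (t + h))) (nearest_index e n (f t)).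
      by rewrite mdistxx mulr_ge0// ?powR_ge0// ltW.
    apply: le_trans (leM _ _ (nearest_index_le _ _ _) (nearest_index_le _ _ _)) _.
    rewrite ler_peMr ?(ltW M0)//.
    rewrite [leLHS](_ : 1 = 1 `^ p^-1); last by rewrite powR1.
    apply: ge0_ler_powR; rewrite ?nnegrE ?invr_ge0 ?(ltW p0)//.
    have le1 (i j : nat) : i != j -> 1 <= `|i%:R - j%:R| :> R.
      wlog ij : i j / (i < j)%N.
        move=> wl; case: (ltngtP i j) => [ij|ij|//] _; first by apply: wl => //; rewrite ltn_eqF.
        by rewrite distrC; apply: wl => //; rewrite ltn_eqF.
      move=> _; rewrite distrC -natrB ?(ltnW ij)// ger0_norm//.
      by rewrite ler1n subn_gt0.
    exact: le1.
apply: le_trans (wnormD _ _ _ _) _ => //; first exact: nnmeasD.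
rewrite (_ : eps = (eps / 3 + eps / 3) + eps / 3); last by lra.
rewrite 2!EFinD; apply: leeD; last first.
  apply: le_trans nP; apply: wnorm_subset => //; first exact: ltW.
  by move=> t; rewrite /= !in_itv/= => /andP[at_ tb]; apply/andP; split; lra.
apply: le_trans (wnormD _ _ _ _) _ => //.
apply: leeD.
  rewrite (wnorm_shift _ _ _ _ mN).
  apply: le_trans nP; apply: wnorm_subset => //; first exact: ltW.
  move: h1; rewrite ler_norml => /andP[h1 h1'] t; rewrite /= !in_itv/= => /andP[at_ tb].
  by apply/andP; split; lra.
have := etaP h heta.
rewrite (wnorm1 `[a, b] (phi := fun t => `|k (t + h) - k t|) (fun=> normr_ge0 _)).
move=> int_le.
rewrite /wnorm.
have -> : (\int[leb]_(t in `[a, b]) (D t `^ p)%:E =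
    (M `^ p)%:E * \int[leb]_(t in `[a, b]) (`|k (t + h)%R - k t|%R)%:E)%E.
  rewrite -ge0_integralZl_EFin ?powR_ge0//; last exact: nnmeas_EFin.
  apply: eq_integral => t _; rewrite -EFinM powRM ?powR_ge0 ?(ltW M0)//.
  by rewrite -powRrM mulVf ?gt_eqF// powRr1.
apply: le_trans (@ge0_le_poweR _ _ ((M `^ p)%:E * ((eps / 3 / M) `^ p)%:E) _ _ _ _) _ => //.
- by rewrite invr_ge0 ltW.
- by rewrite mule_ge0 ?lee_fin ?powR_ge0// integral_ge0.
- by rewrite lee_pmul2l ?lte_fin ?powR_gt0.
rewrite -EFinM -powRM ?divr_ge0 ?(ltW M0) ?(ltW e0)// (mulrC M) divfK ?gt_eqF//.
by rewrite poweR_EFin -powRrM divff ?gt_eqF// powRr1// ltW.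
Qed.

End translation_continuity.

(** * Common almost periods *)

Section common_periods.
Context {R : realType}.
Implicit Types (T : R -> set R).

(** Pair an almost period [t1 a] of the first kind with one [t2 a] of the second
kind, both close to [a]. The gaps [t1 a - t2 a] are bounded, so up to an error
[eta] they take finitely many values, each reached at some representative [c].
If [a] and [c] have nearly the same gap, then [t1 a - t1 c] is an almost period
of both kinds: it differs from [t2 a - t2 c] by a number so small that it is
itself an almost period of the second kind. Finally [t1 c] is bounded, there
being finitely many representatives. *)
Lemma common_almost_periods T1 T2 :
  (forall eps, 0 < eps -> relatively_dense (T1 eps)) ->
  (forall eps, 0 < eps -> relatively_dense (T2 eps)) ->
  (forall a b s t, T1 a s -> T1 b t -> T1 (a + b) (s - t)) ->
  (forall a b s t, T2 a s -> T2 b t -> T2 (a + b) (s - t)) ->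
  (forall eps, 0 < eps -> exists2 eta : R, 0 < eta & forall h, `|h| <= eta -> T2 eps h) ->
  forall eps, 0 < eps -> relatively_dense (T1 eps `&` T2 eps).
Proof.
move=> d1 d2 B1 B2 small eps e0.
have e2 : 0 < eps / 2 by rewrite divr_gt0.
have e3 : 0 < eps / 3 by rewrite divr_gt0.
have [l1 l1_0 P1] := d1 _ e2; have [l2 l2_0 P2] := d2 _ e3.
have [eta eta0 etaP] := small _ e3.
have /choice[t1 t1P] : forall a, exists t, T1 (eps / 2) t /\ a <= t <= a + l1.
  by move=> a; have [t [? /=]] := P1 a; rewrite in_itv; exists t.
have /choice[t2 t2P] : forall a, exists t, T2 (eps / 3) t /\ a <= t <= a + l2.
  by move=> a; have [t [? /=]] := P2 a; rewrite in_itv; exists t.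
pose gap a := t1 a - t2 a.
pose cell a := Num.truncn ((gap a + l2) / eta).
have gap0 a : 0 <= (gap a + l2) / eta.
  rewrite divr_ge0 ?(ltW eta0)// /gap; have [_] := t1P a; have [_] := t2P a; lra.
have cell_le a : (cell a <= Num.truncn ((l1 + l2) / eta))%N.
  apply: le_truncn; rewrite ler_pM2r ?invr_gt0//.
  rewrite /gap; have [_] := t1P a; have [_] := t2P a; lra.
have /choice[rep repP] : forall j, exists c, forall a, cell a = j -> cell c = j.
  move=> j; have [[c cj]|nj] := pselect (exists c, cell c = j); first by exists c.
  by exists 0 => a aj; exfalso; apply: nj; exists a.
pose N := Num.truncn ((l1 + l2) / eta).
pose Len := \sum_(j < N.+1) `|t1 (rep j)|.
have Len_ge a : `|t1 (rep (cell a))| <= Len.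
  have lt_c : (cell a < N.+1)%N by rewrite ltnS; exact: cell_le.
  rewrite /Len (bigD1 (Ordinal lt_c))//= lerDl sumr_ge0//.
have Len0 : 0 <= Len by exact: sumr_ge0.
exists (l1 + 2 * Len); first by rewrite ltr_wpDr// mulr_ge0.
move=> a'; pose a := a' + Len; pose c := rep (cell a).
have cc : cell c = cell a by exact: repP.
have gap_close : `|gap c - gap a| <= eta.
  have := truncn_itv (gap0 a); have := truncn_itv (gap0 c).
  rewrite -/(cell a) -/(cell c) cc -natr1.
  set u := (cell a)%:R; rewrite !ler_pdivlMr// !ltr_pdivrMr// => /andP[h1 h2] /andP[h3 h4].
  by rewrite ler_norml; apply/andP; split; lra.
exists (t1 a - t1 c); split; last first.
  rewrite /= in_itv/=; have [_] := t1P a; have := Len_ge a; rewrite -/c ler_norml /a.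
  by move=> /andP[? ?] /andP[? ?]; apply/andP; split; lra.
split.
  by rewrite (splitr eps); apply: B1; [exact: (t1P a).1|exact: (t1P c).1].
rewrite (_ : eps = (eps / 3 + eps / 3) + eps / 3); last by lra.
rewrite (_ : t1 a - t1 c = (t2 a - t2 c) - (gap c - gap a)); last by rewrite /gap; ring.
by apply: (B2 _ _ _ _); [apply: (B2 _ _ _ _); [exact: (t2P a).1|exact: (t2P c).1]|exact: etaP].
Qed.

End common_periods.

(** * Stepanov almost periodic functions *)

Section almost_periodic.
Context {R : realType} {E : completeMetricType R}.
Implicit Types (f g : R -> E) (p : R).

Definition almost_period p f (eps tau : R) : Prop := forall x : R,
  (wnorm p `[x, (x + 1)%R] (fun t => mdist (f (t + tau)) (f t))%R <= eps%:E)%E.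

Lemma stepanov_dist_leP p f g (eps : \bar R) : (stepanov_dist p f g <= eps)%E <->
  forall x, (wnorm p `[x, (x + 1)%R] (fun t => mdist (f t) (g t)) <= eps)%E.
Proof.
split=> [le x|le].
  by apply: le_trans le; apply: ereal_sup_ubound; exists x.
by apply: ge_ereal_sup => _ [x _ <-]; exact: le.
Qed.

Lemma stepanov_AP_dense p f : stepanov_AP p f -> forall eps : R, 0 < eps ->
  relatively_dense (almost_period p f eps).
Proof.
move=> [_ d] eps /d[l l0 P]; exists l => // a.
by have [tau [/= + h]] := P a; rewrite stepanov_dist_leP; exists tau.
Qed.

Lemma relatively_dense_sub (A B : set R) : A `<=` B ->
  relatively_dense A -> relatively_dense B.
Proof.
by move=> AB [l l0 P]; exists l => // a; have [t [/AB ? ?]] := P a; exists t.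
Qed.

Lemma measurable_translate f (c : R) : measurable_fun [set: R] (f : R -> borel E) ->
  measurable_fun [set: R] ((fun t => f (t + c)) : R -> borel E).
Proof. by move=> mf; exact: (measurableT_comp mf (measurable_shift c)). Qed.

Lemma nnmeas_mdist f g : measurable_fun [set: R] (f : R -> borel E) ->
  measurable_fun [set: R] (g : R -> borel E) -> nnmeas (fun t => mdist (f t) (g t)).
Proof. by split => [|t]; [exact: measurable_mdist|exact: mdist_ge0]. Qed.

Lemma wnorm_mdist_shift p f g (x y c : R) : measurable_fun [set: R] (f : R -> borel E) ->
  measurable_fun [set: R] (g : R -> borel E) ->
  wnorm p `[x, y] (fun t => mdist (f (t + c)) (g (t + c))) =
  wnorm p `[x + c, y + c] (fun t => mdist (f t) (g t)).
Proof. by move=> mf mg; rewrite -(wnorm_shift p x y c (nnmeas_mdist mf mg)). Qed.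

Lemma almost_periodB p f (a b s t : R) : 1 <= p ->
  measurable_fun [set: R] (f : R -> borel E) ->
  almost_period p f a s -> almost_period p f b t -> almost_period p f (a + b) (s - t).
Proof.
move=> p1 mf sP tP x; have p0 : 0 <= p by exact: le_trans p1.
have mD := nnmeas_mdist.
have mT c := measurable_translate c mf.
apply: (@le_trans _ _ (wnorm p `[x, (x + 1)%R] (fun u =>
    mdist (f (u - t + s)) (f (u - t)) + mdist (f (u - t + t)) (f (u - t)))%R)).
  apply: le_wnorm => //.
  - exact: mD.
  - apply: nnmeasD; apply: mD => //.
      by apply: (@measurable_translate (fun u => f (u + s))).
    by apply: (@measurable_translate (fun u => f (u + t))).
  - move=> u _; rewrite subrK (_ : u + (s - t) = u - t + s); last by ring.
    by rewrite (metric_sym (f u)); exact: metric_triangle.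
apply: le_trans (wnormD _ _ _ _) _ => //.
- apply: mD => //; exact: (@measurable_translate (fun u => f (u + s))).
- apply: mD => //; exact: (@measurable_translate (fun u => f (u + t))).
rewrite EFinD; apply: leeD.
  rewrite (wnorm_mdist_shift p x (x + 1) (- t) (mT s) mf).
  by rewrite addrAC; exact: sP.
rewrite (wnorm_mdist_shift p x (x + 1) (- t) (mT t) mf).
by rewrite addrAC; exact: tP.
Qed.

(** The principle behind the next three lemmas: up to [eps], every unit window of [f]
is the translate of a window inside one fixed compact interval. *)
Lemma stepanov_AP_window p f (eps : R) : stepanov_AP p f -> 0 < eps ->
  exists l : R, forall x, exists tau, [/\ almost_period p f eps tau, 0 <= x + tau & x + tau <= l].
Proof.
move=> fAP e0; have [l l0 P] := stepanov_AP_dense fAP e0; exists l => x.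
have [tau [tauP /=]] := P (- x); rewrite in_itv/= => /andP[h1 h2].
by exists tau; split => //; lra.
Qed.

Lemma stepanov_AP_bounded p f (x0 : E) : 1 <= p -> stepanov_AP p f ->
  exists2 M : R, 0 <= M & forall x, (wnorm p `[x, (x + 1)%R] (fun t => mdist (f t) x0) <= M%:E)%E.
Proof.
move=> p1 fAP; have p0 : 0 <= p by exact: le_trans p1.
have [lf _] := fAP; have mf := lf.1.
have [l lP] := stepanov_AP_window fAP (@ltr01 R).
have := locally_integrable_wnorm x0 0 (l + 1) p1 lf.
have := wnorm_ge0 p `[0, l + 1] (fun t => mdist (f t) x0).
set W := wnorm p _ _ => W0 Wfin.
have WE : W = (fine W)%:E by rewrite fineK// ge0_fin_numE.
exists (1 + fine W); first by rewrite addr_ge0// fine_ge0.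
move=> x; have [tau [tauP h0 hl]] := lP x.
have mx := nnmeas_mdist_cst mf x0.
have mt := measurable_translate tau mf.
apply: (@le_trans _ _ (wnorm p `[x, (x + 1)%R] (fun t =>
   mdist (f (t + tau)) (f t) + mdist (f (t + tau)) x0)%R)).
  apply: le_wnorm => //.
  - by apply: nnmeasD; [exact: nnmeas_mdist|exact: nnmeas_mdist_cst].
  - by move=> t _; rewrite [X in X + _]metric_sym; exact: metric_triangle.
apply: le_trans (wnormD _ _ _ _) _ => //; [exact: nnmeas_mdist|exact: nnmeas_mdist_cst|].
rewrite EFinD -WE; apply: leeD; first exact: tauP.
rewrite (wnorm_shift p x (x + 1) tau mx); apply: wnorm_subset => //.
by move=> t /=; rewrite !in_itv/= => /andP[? ?]; apply/andP; split; lra.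
Qed.

(** In the sense of Stepanov, the range of an almost periodic function is totally
bounded: one finite net serves all windows. This replaces the compact sets of
values of the continuous theory. *)
Lemma stepanov_AP_net p f (e : nat -> E) (delta : R) : 1 <= p -> stepanov_AP p f ->
  (forall t (eps : R), 0 < eps -> exists n, mdist (f t) (e n) < eps) -> 0 < delta ->
  exists n, forall x, (wnorm p `[x, (x + 1)%R] (fun t => net_dist e n (f t)) <= delta%:E)%E.
Proof.
move=> p1 fAP e_dense d0; have p0 : 0 <= p by exact: le_trans p1.
have [lf _] := fAP; have mf := lf.1.
have d2 : 0 < delta / 2 by rewrite divr_gt0.
have [l lP] := stepanov_AP_window fAP d2.
have [n nP] := net_dist_cvg mf e_dense p1 d2 (locally_integrable_wnorm (e 0%N) 0 (l + 1) p1 lf).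
exists n => x; have [tau [tauP h0 hl]] := lP x.
have mn := nnmeas_net_dist e mf n.
have mt := measurable_translate tau mf.
apply: (@le_trans _ _ (wnorm p `[x, (x + 1)%R] (fun t =>
   mdist (f (t + tau)) (f t) + net_dist e n (f (t + tau)))%R)).
  apply: le_wnorm => //.
  - by apply: nnmeasD; [exact: nnmeas_mdist|exact: nnmeas_net_dist].
  - by move=> t _; rewrite [X in X + _]metric_sym; exact: net_dist_triangle.
apply: le_trans (wnormD _ _ _ _) _ => //; [exact: nnmeas_mdist|exact: nnmeas_net_dist|].
rewrite (splitr delta) EFinD; apply: leeD; first exact: tauP.
rewrite (wnorm_shift p x (x + 1) tau mn); apply: le_trans nP; apply: wnorm_subset => //.
by move=> t /=; rewrite !in_itv/= => /andP[? ?]; apply/andP; split; lra.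
Qed.

Lemma stepanov_AP_uniformly_continuous p f (eps : R) : 1 <= p -> stepanov_AP p f ->
  0 < eps -> exists2 eta : R, 0 < eta & forall h, `|h| <= eta -> almost_period p f eps h.
Proof.
move=> p1 fAP e0; have p0 : 0 <= p by exact: le_trans p1.
have [lf _] := fAP; have mf := lf.1.
have e3 : 0 < eps / 3 by rewrite divr_gt0.
have [l lP] := stepanov_AP_window fAP e3.
have [eta eta0 etaP] := translation_continuity 0 (l + 1) p1 lf e3.
exists eta => // h heta x; have [tau [tauP h0 hl]] := lP x.
have mT c := measurable_translate c mf.
have mTT c d := measurable_translate d (mT c).
apply: (@le_trans _ _ (wnorm p `[x, (x + 1)%R] (fun t =>
   (mdist (f (t + h + tau)) (f (t + h)) + mdist (f (t + tau + h)) (f (t + tau)))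
   + mdist (f (t + tau)) (f t))%R)).
  apply: le_wnorm => //.
  - exact: nnmeas_mdist.
  - by apply: nnmeasD; [apply: nnmeasD|]; exact: nnmeas_mdist.
  - move=> t _; apply: le_trans (metric_triangle _ (f (t + tau)) _) _; rewrite lerD2r.
    apply: le_trans (metric_triangle _ (f (t + h + tau)) _) _.
    by rewrite [X in X + _]metric_sym (addrAC t tau h).
apply: le_trans (wnormD _ _ _ _) _ => //.
- by apply: nnmeasD; exact: nnmeas_mdist.
- exact: nnmeas_mdist.
rewrite (_ : eps = (eps / 3 + eps / 3) + eps / 3); last by lra.
rewrite 2!EFinD; apply: leeD; last exact: tauP.
apply: le_trans (wnormD _ _ _ _) _ => //.
- exact: nnmeas_mdist.
- exact: nnmeas_mdist.
apply: leeD.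
  rewrite (wnorm_mdist_shift p x (x + 1) h (mT tau) mf) addrAC; exact: tauP.
rewrite (wnorm_mdist_shift p x (x + 1) tau (mT h) mf).
apply: le_trans (etaP h heta); apply: wnorm_subset => //; first exact: nnmeas_mdist.
by move=> t /=; rewrite !in_itv/= => /andP[? ?]; apply/andP; split; lra.
Qed.

End almost_periodic.

(** * The Bochner transform as a family of windows *)

Section windows.
Context {R : realType}.
Notation leb := (@lebesgue_measure R).

Lemma windows_lty p (phi : R -> R) (M : R) : 1 <= p -> nnmeas phi ->
  (forall x, (wnorm p `[x, (x + 1)%R] phi <= M%:E)%E) ->
  forall a b, (wnorm p `[a, b] phi < +oo)%E.
Proof.
move=> p1 mphi bnd a b; have p0 : 0 < p by exact: lt_le_trans p1.
have fin1 x : (\int[leb]_(t in `[x, (x + 1)%R]) ((phi t) `^ p)%:E < +oo)%E.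
  by apply/(wnorm_lty _ _ p0); apply: le_lt_trans (bnd x) _; exact: ltry.
have finn n : (\int[leb]_(t in `[a, (a + n%:R)%R]) ((phi t) `^ p)%:E < +oo)%E.
  elim: n => [|n IHn].
    rewrite addr0 set_itv1 integral_set1 ?ltry//.
  have nonneg t : (0 <= ((phi t) `^ p)%:E)%E by rewrite lee_fin powR_ge0.
  have mphip A : measurable_fun A (fun t => ((phi t) `^ p)%:E).
    by apply: nnmeas_EFin; exact: nnmeas_powR.
  rewrite -natr1 addrA (@itv_bndbnd_setU _ _ _ (BLeft (a + n%:R))); last 2 first.
  - by rewrite bnd_simp lerDl.
  - by rewrite bnd_simp lerDl.
  rewrite ge0_integral_setU//; last first.
    rewrite disj_set2E; apply/eqP; rewrite -subset0 => t [/=].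
    by rewrite !in_itv/= => /andP[_ h1] /andP[h2 _]; move: (lt_le_trans h1 h2); rewrite ltxx.
    exact: mphip.
  apply: lte_add_pinfty; last exact: fin1.
  apply: le_lt_trans IHn; apply: ge0_subset_integral => //; first exact: mphip.
  by move=> t /=; rewrite !in_itv/= => /andP[-> /ltW].
apply/(wnorm_lty _ _ p0); apply: le_lt_trans (finn (Num.truncn `|b - a|).+1).
apply: ge0_subset_integral => //.
- by apply: nnmeas_EFin; exact: nnmeas_powR.
- by move=> t _; rewrite lee_fin powR_ge0.
- move=> t /=; rewrite !in_itv/= => /andP[-> tb] /=; apply: le_trans tb _.
  rewrite -lerBlDl (le_trans (ler_norm _))// ltW// truncnS_gt//.
Qed.

(** Tonelli's theorem for [(t, s) |-> phi (s + t) ^ p] on the strip [0 <= s <= 1]. *)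
Lemma measurable_wnorm_window p (phi : R -> R) : nnmeas phi ->
  measurable_fun [set: measurableTypeR R] (fun t => wnorm p `[t, (t + 1)%R] phi).
Proof.
move=> mphi.
pose F (ts : measurableTypeR R * measurableTypeR R) : \bar R :=
  ((phi (ts.2 + ts.1)) `^ p * \1_(`[0, 1]%classic : set R) ts.2)%:E.
have mF : measurable_fun setT F.
  apply/measurable_EFinP; apply: measurable_funM.
    have mpp := (nnmeas_powR p mphi).1.
    apply: (measurableT_comp mpp).
    exact: (measurable_funD (f := snd) (g := fst)).
  by apply: measurableT_comp => //.
have F0 ts : (0 <= F ts)%E by rewrite lee_fin mulr_ge0// ?powR_ge0.
have := measurable_fun_fubini_tonelli_F (m2 := leb) F mF F0.
move=> /(measurableT_comp (measurable_poweR p^-1)).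
congr (measurable_fun _ _); apply/funext => t /=.
have := wnorm_shift p 0 1 t mphi; rewrite add0r (addrC 1) => <-.
apply: (congr1 (fun z => z `^ p^-1)%E).
rewrite /fubini_F [RHS]integral_mkcond; apply: eq_integral => s _.
rewrite /F /patch /= indicE; case: ifPn => _; first by rewrite mulr1.
by rewrite mulr0.
Qed.

Lemma Lp_dist_bochner {E : completeMetricType R} p (f g : R -> E) t :
  measurable_fun [set: R] (f : R -> borel E) ->
  measurable_fun [set: R] (g : R -> borel E) ->
  Lp_dist p (bochner_transform f t) (bochner_transform g t) =
  wnorm p `[t, (t + 1)%R] (fun s => mdist (f s) (g s)).
Proof.
move=> mf mg.
have := wnorm_mdist_shift p 0 1 t mf mg; rewrite add0r (addrC 1) => <-.
by apply: eq_wnorm => s _; rewrite /bochner_transform (addrC t).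
Qed.

End windows.

(** * Means over large intervals *)

Section means.
Context {R : realType} (mu : {measure set (measurableTypeR R) -> \bar R}).
Implicit Types (phi psi : R -> \bar R).

Definition nnemeas phi := measurable_fun [set: measurableTypeR R] phi /\ forall t, (0 <= phi t)%E.

Lemma mean_ge0 phi rho : (forall t, 0 <= phi t)%E -> (0 <= mean mu phi rho)%E.
Proof.
move=> phi0; apply: mule_ge0; last by apply: integral_ge0.
by rewrite inve_ge0.
Qed.

Lemma le_mean phi psi rho : nnemeas phi -> nnemeas psi ->
  (forall t, phi t <= psi t)%E -> (mean mu phi rho <= mean mu psi rho)%E.
Proof.
move=> [mphi phi0] [mpsi psi0] le; apply: lee_wpmul2l; first by rewrite inve_ge0.
apply: ge0_le_integral => //; exact: measurable_funTS.
Qed.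

Lemma meanD phi psi rho : nnemeas phi -> nnemeas psi ->
  mean mu (fun t => phi t + psi t)%E rho = (mean mu phi rho + mean mu psi rho)%E.
Proof.
move=> [mphi phi0] [mpsi psi0]; rewrite /mean ge0_integralD//; [|exact: measurable_funTS..].
by rewrite ge0_muleDr// integral_ge0.
Qed.

Lemma meanZ phi (c : R) rho : 0 <= c -> nnemeas phi ->
  mean mu (fun t => c%:E * phi t)%E rho = (c%:E * mean mu phi rho)%E.
Proof.
move=> c0 [mphi phi0]; rewrite /mean ge0_integralZl_EFin//; first by rewrite muleCA.
exact: measurable_funTS.
Qed.

(** The bound is an inequality because the interval may have measure [0] or [+oo]. *)
Lemma mean_cst_le (c rho : R) : 0 <= c -> (mean mu (fun=> c%:E) rho <= c%:E)%E.
Proof.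
move=> c0; rewrite /mean integral_cst//.
have := measure_ge0 mu `[(- rho)%R, rho]; set m := mu _ => m0.
have [->|mn0] := eqVneq m 0%E; first by rewrite mule0 mule0 lee_fin.
have [->|mfin] := eqVneq m +oo%E; first by rewrite invey mul0e lee_fin.
have mf : m \is a fin_num by rewrite ge0_fin_numE// lt_neqAle mfin leey.
by rewrite muleCA mulVe// ?mule1// .
Qed.

Lemma nnemeasD phi psi : nnemeas phi -> nnemeas psi -> nnemeas (fun t => phi t + psi t)%E.
Proof.
by move=> [mf f0] [mg g0]; split; [exact: emeasurable_funD|move=> t; exact: adde_ge0].
Qed.

Lemma nnemeasZ phi (c : R) : 0 <= c -> nnemeas phi -> nnemeas (fun t => c%:E * phi t)%E.
Proof.
move=> c0 [mf f0]; split; first exact: measurable_funeM.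
by move=> t; rewrite mule_ge0.
Qed.

Lemma nnemeas_sum (n : nat) (f : nat -> R -> \bar R) : (forall i, nnemeas (f i)) ->
  nnemeas (fun t => \sum_(i < n) f i t)%E.
Proof.
move=> mf; split; last by move=> t; apply: sume_ge0 => i _; exact: (mf i).2.
by apply: emeasurable_sum => i; exact: (mf i).1.
Qed.

Lemma nnemeas_cst (c : R) : 0 <= c -> nnemeas (fun=> c%:E).
Proof. by move=> c0; split => // t; rewrite lee_fin. Qed.

Lemma nnemeas_wnorm p (phi : R -> R) : nnmeas phi ->
  nnemeas (fun t => wnorm p `[t, (t + 1)%R] phi).
Proof. by move=> mphi; split; [exact: measurable_wnorm_window|move=> t; exact: wnorm_ge0]. Qed.

Lemma mean_sum (n : nat) (f : nat -> R -> \bar R) rho : (forall i, nnemeas (f i)) ->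
  mean mu (fun t => \sum_(i < n) f i t)%E rho = (\sum_(i < n) mean mu (f i) rho)%E.
Proof.
move=> mf; elim: n => [|n IHn].
  rewrite big_ord0 /mean; under eq_integral do rewrite big_ord0.
  by rewrite integral0 mule0.
rewrite big_ord_recr/= -IHn -meanD//; last exact: nnemeas_sum.
by congr mean; apply/funext => t; rewrite big_ord_recr.
Qed.

Lemma cvg_to0P (T : Type) (F : set_system T) (u : T -> \bar R) : Filter F ->
  (forall x, 0 <= u x)%E ->
  (u @ F --> 0%E <-> forall eps : R, 0 < eps -> \forall x \near F, (u x <= eps%:E)%E).
Proof.
move=> FF u0; split.
  move=> /fine_cvgP[fin_u /cvgrPdist_le small] eps e0.
  have {}small := small eps e0.
  near=> x; rewrite -(@fineK _ (u x)); last by near: x.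
  rewrite lee_fin; apply: le_trans (ler_norm _) _.
  by rewrite -normrN -sub0r; near: x.
move=> small; apply/fine_cvgP; split.
  have := small 1 ltr01; apply: filterS => x ux.
  by rewrite ge0_fin_numE// (le_lt_trans ux)// ltry.
apply/cvgrPdist_le => eps e0; have := small eps e0; apply: filterS => x ux /=.
rewrite sub0r normrN ger0_norm ?fine_ge0//.
rewrite -lee_fin fineK// ge0_fin_numE// (le_lt_trans ux)// ltry.
Unshelve. all: by end_near. Qed.

End means.

(** * Superposition operators *)

Section nemytskii.
Context {R : realType} {E : completeMetricType R}.
Implicit Types (F G : R -> E -> E) (X Y : R -> E) (p q r : R) (L : R -> R).

Lemma measurable_nemytskii F X :
  measurable_fun [set: R * borel E] (fun tx => F tx.1 tx.2 : borel E) ->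
  measurable_fun [set: R] (X : R -> borel E) ->
  measurable_fun [set: R] ((fun t => F t (X t)) : R -> borel E).
Proof.
move=> mF mX.
exact: (measurableT_comp mF (measurable_fun_pair (@measurable_id _ _ _) mX)).
Qed.

Lemma stepanov_space_window r L : 1 <= r -> (forall t, 0 <= L t) -> stepanov_space r L ->
  nnmeas L /\ exists2 M : R, 0 <= M & forall x, (wnorm r `[x, (x + 1)%R] L <= M%:E)%E.
Proof.
move=> r1 L0 [mL]; set S := ereal_sup _ => Sfin; split; first by [].
have le x : (wnorm r `[x, (x + 1)%R] L <= S)%E.
  apply: ereal_sup_ubound; exists x => //; apply: eq_wnorm => t _.
  by rewrite ger0_norm.
have S0 : (0 <= S)%E by apply: le_trans (le 0); exact: wnorm_ge0.
exists (fine S); first exact: fine_ge0.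
by move=> x; rewrite fineK// ge0_fin_numE.
Qed.

(** Hoelder's inequality for a weight [L] in the Stepanov space, at a translate by
[c]. *)
Lemma wnorm_weight p q r L (M c x : R) (phi : R -> R) :
  1 <= p -> 1 <= q -> 1 <= r -> p^-1 = q^-1 + r^-1 ->
  nnmeas L -> (forall x, (wnorm r `[x, (x + 1)%R] L <= M%:E)%E) -> nnmeas phi ->
  (wnorm p `[x, (x + 1)%R] (fun t => L (t + c) * phi t)%R
   <= M%:E * wnorm q `[x, (x + 1)%R] phi)%E.
Proof.
move=> p1 q1 r1 pqr mL LM mphi.
apply: le_trans (wnormM p1 q1 r1 pqr _ (nnmeas_shift c mL) mphi) _ => //.
apply: lee_wpmul2r; first exact: wnorm_ge0.
by rewrite (wnorm_shift r x (x + 1) c mL) addrAC; exact: LM.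
Qed.

Lemma wnorm_weight0 p q r L (M x : R) (phi : R -> R) :
  1 <= p -> 1 <= q -> 1 <= r -> p^-1 = q^-1 + r^-1 ->
  nnmeas L -> (forall x, (wnorm r `[x, (x + 1)%R] L <= M%:E)%E) -> nnmeas phi ->
  (wnorm p `[x, (x + 1)%R] (fun t => L t * phi t)%R
   <= M%:E * wnorm q `[x, (x + 1)%R] phi)%E.
Proof.
move=> p1 q1 r1 pqr mL LM mphi.
have := wnorm_weight 0 x p1 q1 r1 pqr mL LM mphi.
by under [X in wnorm _ _ X]eq_fun do rewrite addr0.
Qed.

(** Compare [F t (X t)] with [F t x0]. *)
Lemma nemytskii_window_bounded p q r F L X (x0 : E) (ML MF MX : R) :
  1 <= p -> 1 <= q -> 1 <= r -> p^-1 = q^-1 + r^-1 ->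
  measurable_fun [set: R * borel E] (fun tx => F tx.1 tx.2 : borel E) ->
  measurable_fun [set: R] (X : R -> borel E) ->
  nnmeas L -> (forall t u v, mdist (F t u) (F t v) <= L t * mdist u v) -> 0 <= ML ->
  (forall x, (wnorm r `[x, (x + 1)%R] L <= ML%:E)%E) ->
  (forall x, (wnorm q `[x, (x + 1)%R] (fun t => mdist (X t) x0) <= MX%:E)%E) ->
  (forall x, (wnorm p `[x, (x + 1)%R] (fun t => mdist (F t x0) x0) <= MF%:E)%E) ->
  forall x, (wnorm p `[x, (x + 1)%R] (fun t => mdist (F t (X t)) x0) <= (ML * MX + MF)%:E)%E.
Proof.
move=> p1 q1 r1 pqr mF mX mL lipF ML0 LM XM FM x.
have p0 : 0 <= p by exact: le_trans p1.
have mFX := measurable_nemytskii mF mX.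
have mF0 := measurable_nemytskii mF (@measurable_cst _ _ _ _ _ (x0 : borel E)).
apply: (@le_trans _ _ (wnorm p `[x, (x + 1)%R]
    (fun t => L t * mdist (X t) x0 + mdist (F t x0) x0)%R)).
  apply: le_wnorm => //.
  - exact: nnmeas_mdist_cst.
  - apply: nnmeasD; [apply: nnmeasM => //|]; exact: nnmeas_mdist_cst.
  - move=> t _; apply: le_trans (metric_triangle _ (F t x0) _) _.
    by rewrite lerD2r lipF.
apply: le_trans (wnormD _ _ _ _) _ => //.
- by apply: nnmeasM => //; exact: nnmeas_mdist_cst.
- exact: nnmeas_mdist_cst.
rewrite EFinD; apply: leeD; last exact: FM.
apply: le_trans (wnorm_weight0 _ p1 q1 r1 pqr mL LM (nnmeas_mdist_cst mX x0)) _.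
by rewrite EFinM; apply: lee_wpmul2l; rewrite ?lee_fin.
Qed.

Lemma window_bounded_locally_integrable p (f : R -> E) (x0 : E) (M : R) : 1 <= p ->
  measurable_fun [set: R] (f : R -> borel E) ->
  (forall x, (wnorm p `[x, (x + 1)%R] (fun t => mdist (f t) x0) <= M%:E)%E) ->
  locally_integrable_p p f.
Proof.
move=> p1 mf bnd; split => //; exists x0 => a b _.
have p0 : 0 < p by exact: lt_le_trans p1.
by apply/(wnorm_lty _ _ p0); apply: windows_lty bnd a b => //; exact: nnmeas_mdist_cst.
Qed.

Lemma bochner_bounded_window p (f : R -> E) (x0 : E) : 1 <= p ->
  locally_integrable_p p f -> Lp_bounded_continuous p (bochner_transform f) ->
  exists2 M : R, 0 <= M &
    forall x, (wnorm p `[x, (x + 1)%R] (fun t => mdist (f t) x0) <= M%:E)%E.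
Proof.
move=> p1 lf [[M MP] _]; have mf := lf.1; have p0 : 0 <= p by exact: le_trans p1.
have := locally_integrable_wnorm x0 0 1 p1 lf.
have := wnorm_ge0 p `[0, 1] (fun t => mdist (f t) x0).
set W := wnorm p _ _ => W0 Wfin.
have WE : W = (fine W)%:E by rewrite fineK// ge0_fin_numE.
have M0 : 0 <= M by rewrite -lee_fin; apply: le_trans (MP 0 0); exact: poweR_ge0.
exists (M + fine W); first by rewrite addr_ge0// fine_ge0.
move=> x.
have -> : wnorm p `[x, (x + 1)%R] (fun t => mdist (f t) x0) =
    wnorm p `[0, 1] (fun t => mdist (f (t + x)) x0).
  by rewrite (wnorm_shift p 0 1 x (nnmeas_mdist_cst mf x0)) add0r (addrC 1).
have mfx := measurable_translate x mf.
apply: (@le_trans _ _ (wnorm p `[0, 1] (fun t => mdist (f (t + x)) (f t) + mdist (f t) x0)%R)).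
  apply: le_wnorm => //.
  - exact: (nnmeas_mdist_cst mfx).
  - by apply: nnmeasD; [exact: nnmeas_mdist|exact: nnmeas_mdist_cst].
  - by move=> t _; exact: metric_triangle.
apply: le_trans (wnormD _ _ _ _) _ => //; [exact: nnmeas_mdist|exact: nnmeas_mdist_cst|].
rewrite EFinD -WE; apply: leeD => //; apply: le_trans (MP x 0).
rewrite le_eqVlt; apply/orP; left; apply/eqP.
by apply: eq_wnorm => s _; rewrite /bochner_transform add0r addrC.
Qed.

(** Continuity of the Bochner transform is continuity of translations on one
window. *)
Lemma window_bounded_bochner p (f : R -> E) (x0 : E) (M : R) : 1 <= p ->
  measurable_fun [set: R] (f : R -> borel E) ->
  (forall x, (wnorm p `[x, (x + 1)%R] (fun t => mdist (f t) x0) <= M%:E)%E) ->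
  Lp_bounded_continuous p (bochner_transform f).
Proof.
move=> p1 mf bnd; have p0 : 0 <= p by exact: le_trans p1.
have LpE t u : Lp_dist p (bochner_transform f t) (bochner_transform f u) =
    wnorm p `[0, 1] (fun s => mdist (f (s + t)) (f (s + u))).
  by apply: eq_wnorm => s _; rewrite /bochner_transform addrC [u + s]addrC.
have mT c := measurable_translate c mf.
split.
  exists (M + M) => t u; rewrite LpE.
  apply: (@le_trans _ _ (wnorm p `[0, 1] (fun s => mdist (f (s + t)) x0 + mdist (f (s + u)) x0)%R)).
    apply: le_wnorm => //.
    - exact: nnmeas_mdist.
    - by apply: nnmeasD; [exact: (nnmeas_mdist_cst (mT t))|exact: (nnmeas_mdist_cst (mT u))].
    - by move=> s _; rewrite (metric_sym (f (s + u)) x0); exact: metric_triangle.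
  have m0 := nnmeas_mdist_cst mf x0.
  apply: le_trans (wnormD _ _ (nnmeas_shift t m0) (nnmeas_shift u m0)) _ => //.
  rewrite (wnorm_shift p 0 1 t m0) (wnorm_shift p 0 1 u m0) !add0r !(addrC 1).
  by rewrite EFinD; apply: leeD.
move=> t; apply/cvg_to0P; first by move=> u; exact: poweR_ge0.
move=> eps e0.
have lf := window_bounded_locally_integrable p1 mf bnd.
have [eta eta0 etaP] := translation_continuity t (t + 1) p1 lf e0.
exists eta => // u /= ut; rewrite LpE.
have -> : wnorm p `[0, 1] (fun s => mdist (f (s + u)) (f (s + t))) =
    wnorm p `[t, (t + 1)%R] (fun s => mdist (f (s + (u - t))) (f s)).
  have := wnorm_mdist_shift p 0 1 t (mT (u - t)) mf; rewrite add0r (addrC 1) => <-.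
  by congr wnorm; apply/funext => s; rewrite -addrA (addrC t) subrK.
by apply: etaP; rewrite distrC ltW.
Qed.

(** For a common almost period [tau] of [Y] and of the functions [G (., e i)] of a
finite net, move from [G (t + tau) (Y (t + tau))] to [G t (Y t)] through
[G (t + tau) (Y t)], [G (t + tau) (e k)] and [G t (e k)], where [e k] is the point
of the net nearest to [Y t]. The Lipschitz condition and Hoelder's inequality
bound three of the steps; the remaining one is bounded by the sum over the net
of the distances between [G (t + tau) (e i)] and [G t (e i)]. *)
Lemma nemytskii_AP p q r G L Y :
  1 <= p -> 1 <= q -> 1 <= r -> p^-1 = q^-1 + r^-1 ->
  stepanov_APUc p G -> nnmeas L -> (exists2 ML : R, 0 <= ML &
    forall x, (wnorm r `[x, (x + 1)%R] L <= ML%:E)%E) ->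
  (forall t u v, mdist (G t u) (G t v) <= L t * mdist u v) ->
  stepanov_AP q Y -> stepanov_AP p (fun t => G t (Y t)).
Proof.
move=> p1 q1 r1 pqr [mG GAP GU] mL [ML ML0 LM] lipG YAP.
have p0 : 0 <= p by exact: le_trans p1.
have [[mY _] _] := YAP.
have mGY := measurable_nemytskii mG mY.
split.
  have x0 := Y 0.
  have [MY _ MYP] := stepanov_AP_bounded x0 q1 YAP.
  have [MG _ MGP] := stepanov_AP_bounded x0 p1 (GAP x0).
  apply: (window_bounded_locally_integrable p1 mGY).
  exact: (nemytskii_window_bounded p1 q1 r1 pqr mG mY mL lipG ML0 LM MYP MGP).
move=> eps e0.
have [e e_dense] := measurable_range_separable mY.
have ML1 : 0 < ML + 1 by rewrite ltr_wpDl.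
pose delta := eps / 3 / (ML + 1).
have d0 : 0 < delta by rewrite !divr_gt0.
have [n nP] := stepanov_AP_net q1 YAP e_dense d0.
(* The step in [Y] costs [ML * e1] and the [n.+1] points of the net [e1] each; the two
   steps to and from the net cost [ML * delta] each. *)
pose e1 := eps / 3 / (ML + 1 + n.+1%:R).
have e10 : 0 < e1 by rewrite !divr_gt0// addr_gt0.
pose T1 (a : R) : set R := [set tau | forall i, (i <= n)%N -> almost_period p (G ^~ (e i)) a tau].
have mGe i : measurable_fun [set: R] ((G ^~ (e i)) : R -> borel E).
  exact: (GAP (e i)).1.1.
have dT1 a : 0 < a -> relatively_dense (T1 a).
  move=> a0; have cC : compact (e @` `I_n.+1).
    by apply: finite_compact; apply: finite_image; exact: finite_II.
  apply: relatively_dense_sub (GU _ cC a a0) => tau /= le i lin.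
  apply/stepanov_dist_leP; apply: le_trans le; apply: ereal_sup_ubound.
  by exists (e i) => //; exists i.
have : relatively_dense (T1 e1 `&` almost_period q Y e1).
  apply: common_almost_periods => //.
  - exact: stepanov_AP_dense.
  - by move=> a b s t sP tP i lin; apply: almost_periodB; [|exact: mGe|exact: sP|exact: tP].
  - by move=> a b s t; exact: almost_periodB.
  - by move=> a a0; exact: stepanov_AP_uniformly_continuous.
apply: relatively_dense_sub => tau [T1tau T2tau] /=.
apply/stepanov_dist_leP => x.
have mYt := measurable_translate tau mY.
have mN := nnmeas_net_dist e mY n.
have mYY := nnmeas_mdist mYt mY.
have mLt := nnmeas_shift tau mL.
have mGi i : nnmeas (fun t => mdist (G (t + tau) (e i)) (G t (e i))).
  by apply: nnmeas_mdist => //; exact: (measurable_translate tau (mGe i)).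
pose g (i : nat) t := mdist (G (t + tau) (e i)) (G t (e i)).
have mS : nnmeas (fun t => \sum_(i < n.+1) g i t) by exact: (@nnmeas_sum _ n.+1 g).
apply: (@le_trans _ _ (wnorm p `[x, (x + 1)%R] (fun t =>
   ((L (t + tau) * mdist (Y (t + tau)) (Y t) + L (t + tau) * net_dist e n (Y t)) +
   \sum_(i < n.+1) mdist (G (t + tau) (e i)) (G t (e i))) + L t * net_dist e n (Y t))%R)).
  apply: le_wnorm => //.
  - exact: (nnmeas_mdist (measurable_translate tau mGY) mGY).
  - apply: nnmeasD; last exact: nnmeasM.
    apply: nnmeasD; first by apply: nnmeasD; exact: nnmeasM.
    exact: mS.
  - move=> t _; set k := nearest_index e n (Y t).
    have kn : (k <= n)%N by exact: nearest_index_le.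
    apply: le_trans (metric_triangle _ (G t (e k)) _) _; apply: lerD; last first.
      by rewrite metric_sym; exact: lipG.
    apply: le_trans (metric_triangle _ (G (t + tau) (e k)) _) _; apply: lerD; last first.
      rewrite (bigD1 (Ordinal (kn : (k < n.+1)%N)))//= lerDl.
      by apply: sumr_ge0 => i _; exact: mdist_ge0.
    apply: le_trans (metric_triangle _ (G (t + tau) (Y t)) _) _; apply: lerD; exact: lipG.
have mul_le (a b : R) (z : \bar R) : 0 <= a -> (z <= b%:E)%E -> (a%:E * z <= (a * b)%:E)%E.
  by move=> a0 zb; rewrite EFinM; apply: lee_wpmul2l; rewrite ?lee_fin.
have L_net c : (wnorm p `[x, (x + 1)%R]
    (fun t => L (t + c) * net_dist e n (Y t))%R <= (eps / 3)%:E)%E.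
  apply: le_trans (wnorm_weight c x p1 q1 r1 pqr mL LM mN) _.
  apply: le_trans (mul_le _ _ _ ML0 (nP x)) _; rewrite lee_fin /delta mulrA ler_pdivrMr// mulrC.
  by rewrite ler_pM2l ?divr_gt0// lerDl.
have D0 : 0 < ML + 1 + n.+1%:R by rewrite addr_gt0.
have e1_le : ((ML * e1)%:E + (n.+1%:R * e1)%:E <= (eps / 3)%:E)%E.
  rewrite -EFinD -mulrDl lee_fin /e1 mulrA ler_pdivrMr// mulrC.
  by rewrite ler_pM2l ?divr_gt0// lerD2r lerDl.
have sumE : (\sum_(i < n.+1) wnorm p `[x, (x + 1)%R]
    (fun t => mdist (G (t + tau) (e i)) (G t (e i)))%R <= (n.+1%:R * e1)%:E)%E.
  apply: (@le_trans _ _ (\sum_(i < n.+1) e1%:E)%E).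
    by apply: lee_sum => i _; apply: T1tau; rewrite -ltnS.
  by rewrite sumEFin sumr_const card_ord mulr_natl.
have L_Y : (wnorm p `[x, (x + 1)%R]
    (fun t => L (t + tau) * mdist (Y (t + tau)) (Y t))%R <= (ML * e1)%:E)%E.
  apply: le_trans (wnorm_weight tau x p1 q1 r1 pqr mL LM mYY) _.
  exact: mul_le.
apply: le_trans (wnormD _ _ _ _) _ => //; [|exact: nnmeasM|].
  by apply: nnmeasD; [apply: nnmeasD; exact: nnmeasM|exact: mS].
rewrite (_ : eps = (eps / 3 + eps / 3) + eps / 3); last by lra.
rewrite EFinD; apply: leeD; last first.
  by have := L_net 0; under [X in wnorm _ _ X]eq_fun do rewrite addr0.
apply: le_trans (wnormD _ _ _ _) _ => //; first by apply: nnmeasD; exact: nnmeasM.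
rewrite EFinD; apply: (@le_trans _ _ (((ML * e1)%:E + (eps / 3)%:E) + (n.+1%:R * e1)%:E)%E).
  apply: leeD; last first.
    by apply: le_trans (@wnorm_sum _ p _ n.+1 g p1 _ mGi) _.
  by apply: le_trans (wnormD _ _ _ _) _ => //; [exact: nnmeasM|exact: nnmeasM|exact: leeD].
rewrite -addeA [X in (_ + X)%E]addeC addeA [leRHS]addeC.
exact: leeD2r.
Qed.

End nemytskii.

(** * The ergodic part of the composition *)

Section ergodic.
Context {R : realType} {E : completeMetricType R}.

Lemma mdist_realE (h : R) : mdist (h : R^o) (0 : R^o) = `|h|.
Proof. by rewrite /mdist/= sub0r normrN. Qed.

Lemma Lp_norm_bochner p (h : R -> R) t : nnmeas h ->
  Lp_norm p (bochner_transform (h : R -> R^o) t) = wnorm p `[t, (t + 1)%R] h.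
Proof.
move=> mh; have := wnorm_shift p 0 1 t mh; rewrite add0r (addrC 1) => <-.
apply: eq_wnorm => s _; rewrite /bochner_transform mdist_realE ger0_norm ?(addrC t)//.
exact: mh.2.
Qed.

(** Move from [F t (X t)] to [G t (Y t)] through [F t (Y t)], [F t (e k)] and
[G t (e k)], where [e k] is the point of a finite net nearest to [Y t]. The first
step is ergodic because [X] and [Y] differ by an ergodic term, the second and
the last are small because the net is fine, and the third is bounded by a
finite sum of ergodic functions. *)
Lemma nemytskii_ergodic (p q r : R) (mu : {measure set (measurableTypeR R) -> \bar R})
  (F G : R -> E -> E) (LF LG : R -> R) (X Y : R -> E) :
  1 <= p -> 1 <= q -> 1 <= r -> p^-1 = q^-1 + r^-1 ->
  measurable_fun [set: R * borel E] (fun tx => F tx.1 tx.2 : borel E) ->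
  measurable_fun [set: R * borel E] (fun tx => G tx.1 tx.2 : borel E) ->
  (forall x, measurable_fun [set: R] ((F ^~ x) : R -> borel E)) ->
  (forall x, measurable_fun [set: R] ((G ^~ x) : R -> borel E)) ->
  nnmeas LF -> (exists2 M : R, 0 <= M & forall x, (wnorm r `[x, (x + 1)%R] LF <= M%:E)%E) ->
  nnmeas LG -> (exists2 M : R, 0 <= M & forall x, (wnorm r `[x, (x + 1)%R] LG <= M%:E)%E) ->
  (forall t u v, mdist (F t u) (F t v) <= LF t * mdist u v) ->
  (forall t u v, mdist (G t u) (G t v) <= LG t * mdist u v) ->
  (forall x, mean mu (fun t => wnorm p `[t, (t + 1)%R] (fun s => mdist (F s x) (G s x))) rho
    @[rho --> +oo] --> 0%E) ->
  measurable_fun [set: R] (X : R -> borel E) -> stepanov_AP q Y ->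
  mean mu (fun t => wnorm q `[t, (t + 1)%R] (fun s => mdist (X s) (Y s))) rho
    @[rho --> +oo] --> 0%E ->
  mean mu (fun t => wnorm p `[t, (t + 1)%R] (fun s => mdist (F s (X s)) (G s (Y s)))) rho
    @[rho --> +oo] --> 0%E.
Proof.
move=> p1 q1 r1 pqr mF mG mFx mGx mLF [MF MF0 LFM] mLG [MG MG0 LGM] lipF lipG Herg mX YAP XYerg.
have p0 : 0 <= p by exact: le_trans p1.
have mY := YAP.1.1.
have mXY := nnmeas_mdist mX mY.
have mFG := nnmeas_mdist (measurable_nemytskii mF mX) (measurable_nemytskii mG mY).
apply/cvg_to0P; first by move=> rho; apply: mean_ge0 => t; exact: wnorm_ge0.
move=> eps e0.
have [e e_dense] := measurable_range_separable mY.
pose M := MF + MG + 1.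
have M0 : 0 < M by rewrite ltr_wpDl// addr_ge0.
pose delta := eps / 3 / M.
have d0 : 0 < delta by rewrite !divr_gt0.
have [n nP] := stepanov_AP_net q1 YAP e_dense d0.
have mN := nnmeas_net_dist e mY n.
pose h (i : nat) t := mdist (F t (e i)) (G t (e i)).
have mh i : nnmeas (h i) by exact: nnmeas_mdist.
have mS : nnmeas (fun t => \sum_(i < n.+1) h i t) by exact: (@nnmeas_sum _ n.+1 h).
have pointwise t : mdist (F t (X t)) (G t (Y t)) <=
    ((LF t * mdist (X t) (Y t) + LF t * net_dist e n (Y t)) +
     LG t * net_dist e n (Y t)) + \sum_(i < n.+1) h i t.
  set k := nearest_index e n (Y t).
  have kn : (k <= n)%N by exact: nearest_index_le.
  apply: le_trans (metric_triangle _ (F t (Y t)) _) _.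
  rewrite -2!addrA lerD ?lipF//.
  apply: le_trans (metric_triangle _ (F t (e k)) _) _; apply: lerD; first exact: lipF.
  apply: le_trans (metric_triangle _ (G t (e k)) _) _; rewrite addrC; apply: lerD; last first.
    by rewrite metric_sym; exact: lipG.
  rewrite (bigD1 (Ordinal (kn : (k < n.+1)%N)))//= lerDl.
  by apply: sumr_ge0 => i _; exact: mdist_ge0.
pose W i t := wnorm p `[t, (t + 1)%R] (h i).
pose V t := wnorm q `[t, (t + 1)%R] (fun s => mdist (X s) (Y s)).
have window t : (wnorm p `[t, (t + 1)%R] (fun s => mdist (F s (X s)) (G s (Y s)))
    <= (MF%:E * V t + (eps / 3)%:E) + \sum_(i < n.+1) W i t)%E.
  apply: (@le_trans _ _ (wnorm p `[t, (t + 1)%R] (fun t =>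
     (((LF t * mdist (X t) (Y t) + LF t * net_dist e n (Y t)) +
     LG t * net_dist e n (Y t)) + \sum_(i < n.+1) h i t)%R))).
    apply: le_wnorm => //.
    apply: nnmeasD => //; apply: nnmeasD; last exact: nnmeasM.
    by apply: nnmeasD; exact: nnmeasM.
  have net_le (L : R -> R) (ML : R) : nnmeas L -> 0 <= ML ->
      (forall x, (wnorm r `[x, (x + 1)%R] L <= ML%:E)%E) ->
      (wnorm p `[t, (t + 1)%R] (fun t => L t * net_dist e n (Y t))%R <= (ML * delta)%:E)%E.
    move=> mL ML0 LM; apply: le_trans (wnorm_weight0 t p1 q1 r1 pqr mL LM mN) _.
    by rewrite EFinM; apply: lee_wpmul2l; rewrite ?lee_fin.
  have mLX : nnmeas (fun t => LF t * mdist (X t) (Y t)) by exact: nnmeasM.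
  have mLFN : nnmeas (fun t => LF t * net_dist e n (Y t)) by exact: nnmeasM.
  have mLGN : nnmeas (fun t => LG t * net_dist e n (Y t)) by exact: nnmeasM.
  have mLXN := nnmeasD mLX mLFN.
  apply: le_trans (wnormD p1 _ (nnmeasD mLXN mLGN) mS) _ => //.
  apply: leeD; last exact: (@wnorm_sum _ p _ n.+1 h p1).
  apply: le_trans (wnormD p1 _ mLXN mLGN) _ => //.
  apply: le_trans (leeD (wnormD p1 _ mLX mLFN) (net_le _ _ mLG MG0 LGM)) _ => //.
  rewrite -addeA; apply: leeD; first exact: (wnorm_weight0 t p1 q1 r1 pqr mLF LFM mXY).
  apply: le_trans (leeD2r _ (net_le _ _ mLF MF0 LFM)) _.
  rewrite -EFinD -mulrDl lee_fin /delta mulrA ler_pdivrMr// mulrC.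
  by rewrite ler_pM2l ?divr_gt0// /M lerDl.
have nnV : nnemeas V by exact: nnemeas_wnorm.
have nnW i : nnemeas (W i) by exact: nnemeas_wnorm.
have nnMV := nnemeasZ MF0 nnV.
have nnc : nnemeas (fun=> (eps / 3)%:E) by apply: nnemeas_cst; rewrite divr_ge0 ?(ltW e0).
have nnS : nnemeas (fun t => \sum_(i < n.+1) W i t)%E by exact: nnemeas_sum.
have smallV : \forall rho \near +oo, (mean mu V rho <= (eps / 3 / M)%:E)%E.
  apply: (cvg_to0P _ (fun rho => mean_ge0 mu rho nnV.2)).1 XYerg _ _.
  by rewrite !divr_gt0.
have smallW : \forall rho \near +oo, forall i : 'I_n.+1,
    (mean mu (W i) rho <= (eps / 3 / n.+1%:R)%:E)%E.
  apply: filter_forall => i.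
  apply: (cvg_to0P _ (fun rho => mean_ge0 mu rho (nnW i).2)).1 (Herg (e i)) _ _.
  by rewrite !divr_gt0.
near=> rho.
apply: le_trans (le_mean mu rho _ (nnemeasD (nnemeasD nnMV nnc) nnS) window) _.
  exact: nnemeas_wnorm.
rewrite (meanD mu rho (nnemeasD nnMV nnc) nnS) (meanD mu rho nnMV nnc).
rewrite (meanZ mu rho MF0 nnV) mean_sum//.
rewrite [leRHS](_ : _ = ((eps / 3)%:E + (eps / 3)%:E) + (eps / 3)%:E)%E; last first.
  by rewrite -!EFinD; congr EFin; lra. apply: leeD; first apply: leeD.
- have : (mean mu V rho <= (eps / 3 / M)%:E)%E by near: rho.
  have MF0' : (0 <= MF%:E)%E by rewrite lee_fin.
  move=> /(lee_wpmul2l MF0') /le_trans; apply.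
  rewrite -EFinM lee_fin mulrA ler_pdivrMr// mulrC ler_pM2l ?divr_gt0//.
  by rewrite /M -addrA lerDl addr_ge0.
- by apply: mean_cst_le; rewrite divr_ge0 ?(ltW e0).
- apply: (@le_trans _ _ (\sum_(i < n.+1) (eps / 3 / n.+1%:R)%:E)%E).
    apply: lee_sum => i _; move: i; near: rho; exact: smallW.
  by rewrite sumEFin sumr_const card_ord -(mulr_natr (_ / _)) divfK.
Unshelve. all: by end_near. Qed.

End ergodic.

Theorem theorem2p11 (R : realType) (E : completeMetricType R) (p q r : R)
  (p1 : 1 <= p) (q1 : 1 <= q) (r1 : 1 <= r) (pqr : p^-1 = q^-1 + r^-1)
  (mu : {measure set (measurableTypeR R) -> \bar R})
  (mu_infinite : mu setT = +oo%E)
  (mu_bounded : forall I : interval R, bounded_set [set` I] ->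
    (mu [set` I] < +oo)%E)
  (mu_translation : forall tau : R, exists beta : R, exists I : interval R,
    [/\ 0 < beta, bounded_set [set` I] &
        forall B : set R, measurable B -> B `&` [set` I] = set0 ->
          (mu [set b + tau | b in B]%R <= beta%:E * mu B)%E])
  (F G : R -> E -> E)
  (F_PAP : stepanov_PAPUc p mu F)
  (G_AP : stepanov_APUc p G)
  (H_ergodic : stepanov_EUc p mu (fun t x => mdist (F t x) (G t x)))
  (F_Lipschitz : stepanov_Lipschitz r F)
  (G_Lipschitz : stepanov_Lipschitz r G)
  (X : R -> E) (X_PAP : stepanov_PAP q mu X) :
  stepanov_PAP p mu (fun t => F t (X t)).
Proof.
have p0 : 0 <= p by exact: le_trans p1.
have [mF lF _] := F_PAP.
have [mG GAP _] := G_AP.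
have [_ lH ergH _] := H_ergodic.
have [LF [LF0 SLF lipF]] := F_Lipschitz.
have [LG [LG0 SLG lipG]] := G_Lipschitz.
have [mLF LFb] := stepanov_space_window r1 LF0 SLF.
have [mLG LGb] := stepanov_space_window r1 LG0 SLG.
have [lX bX [Y YAP XY0]] := X_PAP.
have mX := lX.1; have mY := YAP.1.1.
have mFx x := (lF x).1; have mGx x := (GAP x).1.1.
have mH x := nnmeas_mdist (mFx x) (mGx x).
have mFX := measurable_nemytskii mF mX.
have mGY := measurable_nemytskii mG mY.
pose x0 := X 0.
have [MX _ XM] := bochner_bounded_window x0 q1 lX bX.
have [MH _ HM] := bochner_bounded_window (0 : R^o) p1 (lH x0) (ergH x0).1.
have [MG _ GM] := stepanov_AP_bounded x0 p1 (GAP x0).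
have FM x : (wnorm p `[x, (x + 1)%R] (fun t => mdist (F t x0) x0) <= (MH + MG)%:E)%E.
  apply: (@le_trans _ _ (wnorm p `[x, (x + 1)%R]
      (fun t => mdist (F t x0) (G t x0) + mdist (G t x0) x0)%R)).
    apply: le_wnorm => //.
    - exact: (nnmeas_mdist_cst (mFx x0)).
    - exact: nnmeasD (mH x0) (nnmeas_mdist_cst (mGx x0) x0).
    - by move=> t _; exact: metric_triangle.
  apply: le_trans (wnormD p1 _ (mH x0) (nnmeas_mdist_cst (mGx x0) x0)) _ => //.
  rewrite EFinD; apply: leeD; last exact: GM.
  apply: le_trans (HM x); rewrite le_eqVlt; apply/orP; left; apply/eqP.
  congr wnorm; apply/funext => t.
  by rewrite mdist_realE ger0_norm// mdist_ge0.
have [ML ML0 LM] := LFb.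
have ZM := nemytskii_window_bounded p1 q1 r1 pqr mF mX mLF lipF ML0 LM XM FM.
split.
- exact: window_bounded_locally_integrable p1 mFX ZM.
- exact: window_bounded_bochner p1 mFX ZM.
exists (fun t => G t (Y t)); first exact: (nemytskii_AP p1 q1 r1 pqr G_AP mLG LGb lipG YAP).
rewrite (funext (fun t => Lp_dist_bochner p t mFX mGY)).
apply: (nemytskii_ergodic p1 q1 r1 pqr mF mG mFx mGx mLF LFb mLG LGb lipF lipG _ mX YAP).
- move=> x; have := (ergH x).2.
  by rewrite (funext (fun t => Lp_norm_bochner p t (mH x))).
- by move: XY0; rewrite (funext (fun t => Lp_dist_bochner q t mX mY)).
Qed.
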